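(* Let $\kappa,\sigma,b$ be real constants and let $$L(\phi) := -\frac{\kappa^2}{2}\partial^4\phi + \frac{\sigma^2}{2}\partial^2\phi - b\,\partial\phi,\qquad A(\phi) := (A_1(\phi),A_2(\phi)),\quad A_1(\phi) := -\sigma\,\partial\phi,\quad A_2(\phi) := \kappa\,\partial^2\phi .$$ Fix $p \in \mathbb{R}$. Then there exists a constant $C = C(p,\kappa,\sigma,b) > 0$ such that $$2\langle \phi, L\phi\rangle_p + \|A\phi\|_{HS(p)}^2 \leq C\|\phi\|_p^2 \quad \text{for all } \phi\in\mathcal{S},$$ where $\|A\phi\|_{HS(p)}^2 := \|A_1\phi\|_p^2 + \|A_2\phi\|_p^2$. Moreover, the inequality is true for all $\phi\in\mathcal{S}_{p+2}$.
   Context: $\mathcal{S}$ is the (real) Schwartz space of rapidly decreasing smooth functions on $\mathbb{R}$, and $\mathcal{S}'$ is its dual, the space of tempered distributions. Let $\langle\cdot,\cdot\rangle_0$ be the usual inner product on $\mathcal{L}^2(\mathbb{R})$ and let $\{h_k\}_{k=0}^\infty$ be the orthonormal basis of $\mathcal{L}^2(\mathbb{R})$ given by the Hermite functions $h_k(t) = (2^k k!\sqrt{\pi})^{-1/2} e^{-t^2/2} H_k(t)$, where $H_k$ are the (physicists') Hermite polynomials. For $p\in\mathbb{R}$ define on $\mathcal{S}$ the inner product $$\langle f,g\rangle_p := \sum_{k=0}^\infty (2k+1)^{2p}\langle f,h_k\rangle_0\langle g,h_k\rangle_0,$$ with norm $\|\cdot\|_p$. The Hermite-Sobolev space $\mathcal{S}_p$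 is the completion of $\mathcal{S}$ in $\|\cdot\|_p$, regarded as a subspace of $\mathcal{S}'$. One has $\mathcal{S}_p\subset\mathcal{S}_q$ for $q<p$. The operator $\partial=\frac{d}{dx}$ acts on $\mathcal{S}$ and is extended to $\mathcal{S}'$ by duality: $\langle\partial\psi,\phi\rangle := -\langle\psi,\partial\phi\rangle$ for $\psi \in \mathcal{S}'$, $\phi\in\mathcal{S}$. It is a bounded linear operator $\mathcal{S}_p\to\mathcal{S}_{p-1/2}$ for each $p \in \mathbb{R}$. Thus $L$, $A_1$, $A_2$ are linear operators on $\mathcal{S}'$ which are bounded from $\mathcal{S}_p$ to $\mathcal{S}_{p-2}$. *)

(* Defs.v *)
From HB Require Import structures.
From mathcomp Require Import all_boot all_order all_algebra.
From mathcomp Require Import all_classical all_reals all_analysis.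
From mathcomp Require Import ring lra.
Import Order.TTheory GRing.Theory Num.Theory.
Import numFieldNormedType.Exports.

Set Implicit Arguments.
Unset Strict Implicit.
Unset Printing Implicit Defensive.

Local Open Scope classical_set_scope.
Local Open Scope ring_scope.

Section schwartz_space.
Context {R : realType}.
Implicit Types f g : R -> R.

Definition is_schwartz f : Prop :=
  (forall (n : nat) (x : R), derivable (derive1n n f) x 1) /\
  (forall m n : nat, exists C : R, forall x : R,
     `|x ^+ m * derive1n n f x| <= C).

Definition schwartz_pred : pred (R -> R) := fun f => `[< is_schwartz f >].

Lemma derive1n_add n f g : is_schwartz f -> is_schwartz g ->
  derive1n n (f + g) = derive1n n f + derive1n n g.
Proof.
move=> [df _] [dg _]; elim: n => [//|n IHn].
rewrite !derive1nS IHn; apply/funext => x.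
rewrite -[RHS]/(derive1 (derive1n n f) x + derive1 (derive1n n g) x) !derive1E.
by rewrite deriveD.
Qed.

Lemma derive1n_scale n (a : R) f : is_schwartz f ->
  derive1n n (a *: f) = a *: derive1n n f.
Proof.
move=> [df _]; elim: n => [//|n IHn].
rewrite !derive1nS IHn; apply/funext => x.
by rewrite -[RHS]/(a *: derive1 (derive1n n f) x) !derive1E deriveZ.
Qed.

Lemma derive1n_zero n : derive1n n (0 : R -> R) = 0.
Proof.
elim: n => [//|n IHn]; rewrite derive1nS IHn; apply/funext => x.
by rewrite derive1E derive_cst.
Qed.

Lemma derive1nSr n f : derive1n n (derive1 f) = derive1n n.+1 f.
Proof. by rewrite /derive1n iterSr. Qed.

Lemma schwartz_submod : submod_closed schwartz_pred.
Proof.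
split.
  apply/asboolP; split=> [n x|m n].
    by rewrite derive1n_zero; exact: derivable_cst.
  exists 0 => x; rewrite derive1n_zero.
  by rewrite -[X in _ * X]/(0 : R) mulr0 normr0.
move=> a f g /asboolP Sf /asboolP Sg; apply/asboolP.
have Saf : is_schwartz (a *: f).
  split=> [n x|m n].
    by rewrite derive1n_scale //; apply: derivableZ; case: Sf.
  have [C HC] := Sf.2 m n; exists (`|a| * C) => x.
  rewrite derive1n_scale // -[X in _ * X]/(a * derive1n n f x) mulrCA normrM.
  by rewrite ler_wpM2l.
split=> [n x|m n].
  by rewrite derive1n_add //; apply: derivableD; [case: Saf|case: Sg].
have [C HC] := Saf.2 m n; have [D HD] := Sg.2 m n; exists (C + D) => x.
rewrite derive1n_add //.
rewrite -[X in _ * X]/(derive1n n (a *: f) x + derive1n n g x) mulrDr.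
by rewrite (le_trans (ler_normD _ _))// lerD.
Qed.

HB.instance Definition _ :=
  GRing.isSubmodClosed.Build R (R -> R) schwartz_pred
    (GRing.submod_closed_semi schwartz_submod).

Record schwartz := Schwartz {
  schwartz_fun :> R -> R ;
  schwartz_funP : schwartz_pred schwartz_fun }.

HB.instance Definition _ := [isSub for schwartz_fun].
HB.instance Definition _ := [Choice of schwartz by <:].
HB.instance Definition _ := [SubChoice_isSubLmodule of schwartz by <:].

Lemma schwartz_deriv_subproof (f : schwartz) : schwartz_pred (derive1 f).
Proof.
have /asboolP [df bf] := schwartz_funP f; apply/asboolP; split => [n x|m n].
  by rewrite derive1nSr; exact: df.
by have [C HC] := bf m n.+1; exists C => x; rewrite derive1nSr.
Qed.

Definition schwartz_deriv (f : schwartz) : schwartz :=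
  Schwartz (schwartz_deriv_subproof f).

Definition schwartz_seminorm (m n : nat) (f : schwartz) : R :=
  sup (range (fun x : R => `|x ^+ m * derive1n n f x|)).

End schwartz_space.
Arguments schwartz R : clear implicits.

Section tempered_distributions.
Context {R : realType}.
Implicit Types u v : schwartz R -> R.

(* Continuity for the topology generated by the seminorms: the sets
   [set g | forall m n <= N, schwartz_seminorm m n (g - f) < d] form a basis
   of neighbourhoods of f. *)
Definition schwartz_continuous u : Prop :=
  forall (f : schwartz R) (e : R), 0 < e -> exists (N : nat) (d : R), 0 < d /\
    forall g : schwartz R,
      (forall m n : nat, (m <= N)%N -> (n <= N)%N ->
         schwartz_seminorm m n (g - f) < d) ->
      `|u g - u f| < e.

Definition is_tempered u : Prop := scalar u /\ schwartz_continuous u.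

Definition tempered_pred : pred (schwartz R -> R) :=
  fun u => `[< is_tempered u >].

Lemma tempered_submod : submod_closed tempered_pred.
Proof.
split.
  apply/asboolP; split=> [a f g|f e e0].
    by rewrite -![(0 : schwartz R -> R) _]/(0 : R) mulr0 addr0.
  exists 0, 1; split=> // g _.
  by rewrite -![(0 : schwartz R -> R) _]/(0 : R) subr0 normr0.
move=> a u v /asboolP[lu cu] /asboolP[lv cv]; apply/asboolP.
have E f : (a *: u + v) f = a * u f + v f by [].
split=> [c f g|f e e0].
  rewrite !E lu lv; ring.
have a1 : 0 < `|a| + 1 by rewrite ltr_wpDl.
have [N1 [d1 [d10 H1]]] := cu f _ (divr_gt0 (divr_gt0 e0 (ltr0n R 2)) a1).
have [N2 [d2 [d20 H2]]] := cv f _ (divr_gt0 e0 (ltr0n R 2)).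
exists (maxn N1 N2), (Num.min d1 d2); split; first by rewrite lt_min d10.
move=> g Hg.
have {}H1 : `|u g - u f| < e / 2 / (`|a| + 1).
  apply: H1 => m n mN nN.
  by have := Hg m n; rewrite lt_min !leq_max mN nN => /(_ isT isT)/andP[].
have {}H2 : `|v g - v f| < e / 2.
  apply: H2 => m n mN nN.
  by have := Hg m n; rewrite lt_min !leq_max mN nN !orbT => /(_ isT isT)/andP[].
rewrite !E.
have -> : a * u g + v g - (a * u f + v f) = a * (u g - u f) + (v g - v f).
  by ring.
rewrite (le_lt_trans (ler_normD _ _))// normrM.
have : (`|a| + 1) * `|u g - u f| <= e / 2.
  by rewrite mulrC -ler_pdivlMr // ltW.
have := normr_ge0 (u g - u f); lra.
Qed.

HB.instance Definition _ :=
  GRing.isSubmodClosed.Build R (schwartz R -> R) tempered_pred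
    (GRing.submod_closed_semi tempered_submod).

Record tempered := Tempered {
  tempered_fun :> schwartz R -> R ;
  tempered_funP : tempered_pred tempered_fun }.

HB.instance Definition _ := [isSub for tempered_fun].
HB.instance Definition _ := [Choice of tempered by <:].
HB.instance Definition _ := [SubChoice_isSubLmodule of tempered by <:].

Lemma schwartz_derivP (a : R) (f g : schwartz R) :
  schwartz_deriv (a *: f + g) = a *: schwartz_deriv f + schwartz_deriv g.
Proof.
apply/val_inj => /=.
have /asboolP Sf := schwartz_funP f; have /asboolP Sg := schwartz_funP g.
have /asboolP Saf := schwartz_funP (a *: f).
by have := derive1n_add 1 Saf Sg; rewrite (derive1n_scale 1 a Sf) !derive1n1.
Qed.

Lemma schwartz_derivB (f g : schwartz R) :
  schwartz_deriv (f - g) = schwartz_deriv f - schwartz_deriv g.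
Proof. by rewrite addrC -scaleN1r schwartz_derivP scaleN1r addrC. Qed.

Lemma seminorm_schwartz_deriv m n (f : schwartz R) :
  schwartz_seminorm m n (schwartz_deriv f) = schwartz_seminorm m n.+1 f.
Proof. by rewrite /schwartz_seminorm /= derive1nSr. Qed.

Lemma tempered_deriv_subproof (u : tempered) :
  tempered_pred (fun f => - u (schwartz_deriv f)).
Proof.
have /asboolP[lu cu] := tempered_funP u; apply/asboolP; split => [a f g|f e e0].
  by rewrite schwartz_derivP lu; ring.
have [N [d [d0 H]]] := cu (schwartz_deriv f) e e0.
exists N.+1, d; split=> // g Hg; rewrite -opprD normrN; apply: H => m n mN nN.
rewrite -schwartz_derivB seminorm_schwartz_deriv.
by apply: Hg => //; exact: leqW.
Qed.

Definition tempered_deriv (u : tempered) : tempered :=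
  Tempered (tempered_deriv_subproof u).

End tempered_distributions.
Arguments tempered R : clear implicits.

Section hermite_sobolev.
Context {R : realType}.

Definition l2_inner (f g : R -> R) : R :=
  \int[lebesgue_measure]_x (f x * g x).

(* H_(k+1) = 2 X H_k - H_k' is obtained by differentiating the Rodrigues
   formula H_k(t) = (-1)^k e^(t^2) (d/dt)^k e^(-t^2). *)
Fixpoint hermite_poly (k : nat) : {poly R} :=
  if k is k'.+1 then 2%:P * 'X * hermite_poly k' - (hermite_poly k')^`()
  else 1.

Definition hermite_fun (k : nat) (t : R) : R :=
  (Num.sqrt (2 ^+ k * k`!%:R * Num.sqrt pi))^-1
  * expR (- (t ^+ 2 / 2)) * (hermite_poly k).[t].

Definition schwartz_inner (p : R) (f g : schwartz R) : R :=
  limn (series (fun k : nat => (2 * k%:R + 1) `^ (2 * p)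
    * l2_inner f (hermite_fun k) * l2_inner g (hermite_fun k))).

Definition schwartz_norm (p : R) (f : schwartz R) : R :=
  Num.sqrt (schwartz_inner p f f).

(* A ||.||_p-Cauchy sequence f of Schwartz functions represents a point of the
   completion of S; this point, viewed in S', is the tempered distribution u
   to which f converges weakly, a Schwartz function g being identified with
   the distribution phi |-> <g, phi>_0. *)
Definition represents (p : R) (f : nat -> schwartz R) (u : tempered R) : Prop :=
  (forall e : R, 0 < e -> exists N : nat, forall m n : nat,
     (N <= m)%N -> (N <= n)%N -> schwartz_norm p (f m - f n) < e) /\
  (forall phi : schwartz R, l2_inner (f n) phi @[n --> \oo] --> u phi).

Definition hermite_sobolev (p : R) : set (tempered R) :=
  [set u | exists f : nat -> schwartz R, represents p f u].

Definition representative (p : R) (u : tempered R) : nat -> schwartz R :=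
  xget (fun=> 0) [set f | represents p f u].

(* The inner product of the completion, meaningful on hermite_sobolev p only,
   where it does not depend on the chosen representatives. *)
Definition sobolev_inner (p : R) (u v : tempered R) : R :=
  limn (fun n : nat =>
    schwartz_inner p (representative p u n) (representative p v n)).

Definition sobolev_norm (p : R) (u : tempered R) : R :=
  Num.sqrt (sobolev_inner p u u).

End hermite_sobolev.

(* V is S or S', and d is the derivative on V. *)
Section operators.
Context {R : realType} {V : lmodType R}.
Variables (d : V -> V) (kappa sigma b : R).

Definition opL (phi : V) : V :=
  - (kappa ^+ 2 / 2) *: d (d (d (d phi))) + (sigma ^+ 2 / 2) *: d (d phi)
  - b *: d phi.

Definition opA1 (phi : V) : V := - sigma *: d phi.

Definition opA2 (phi : V) : V := kappa *: d (d phi).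

Definition opA (phi : V) : V * V := (opA1 phi, opA2 phi).

Definition hs_norm_sq (norm : V -> R) (a : V * V) : R :=
  norm a.1 ^+ 2 + norm a.2 ^+ 2.

End operators.

(* Main.v *)
Require Import Defs.
From mathcomp Require Import all_boot all_order all_algebra.
From mathcomp Require Import all_classical all_reals all_analysis.
From mathcomp Require Import zify measurable_realfun ring lra.
Import Order.TTheory GRing.Theory Num.Theory.
Import numFieldNormedType.Exports.

Set Implicit Arguments.
Unset Strict Implicit.
Unset Printing Implicit Defensive.

Local Open Scope classical_set_scope.
Local Open Scope ring_scope.

(** Write [a k] for the Hermite coefficients of [phi], [w k = (2k+1)^(2p)], and
    [s k = sqrt (k/2)]. Since [h_k' = s k h_(k-1) - s (k+1) h_(k+1)], the
    derivative acts on coefficients as the antisymmetric operator [dstep],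
    [(D a) k = s (k+1) a (k+1) - s k a (k-1)], and everything becomes a
    statement about rapidly decreasing sequences in the weighted space with
    squared norm [sum w a^2].

    If [w] were constant, antisymmetry of [D] would give [<a, D a> = 0],
    [<a, D^2 a> = - |D a|^2] and [<a, D^4 a> = |D^2 a|^2], so the left-hand side
    of the inequality would vanish. In general it is a sum of commutators of
    [D] with [w]. Expanding these and summing by parts, the dangerous terms
    cancel and a quadratic form with the entries [a_k a_(k+j)], [j <= 4],
    remains; its coefficients are sums of first differences of [w] multiplied by
    [O(k)], and second differences of [w] multiplied by [O(k^2)]. As these
    differences are [O(w/k)] and [O(w/k^2)] (the record [slow_weight]), all
    coefficients are [O(w)]. This is [first_order_bound], [second_order_bound]
    and [fourth_order_bound], put together in [generator_bound].

    To transfer this to Schwartz functions one needs that the Hermite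
    coefficients decrease rapidly, so that the defining series converge
    ([hermite_coef_rapid]). This comes from the annihilation operator
    [x + d/dx], which shifts the coefficients and multiplies them by
    [2 s (k+1)], while the coefficients of any Schwartz function are bounded.

    For [phi] in [S_(p+2)], a representing Cauchy sequence [f n] also represents
    [phi] in [S_p], and its images under [L], [A_1], [A_2] represent those of
    [phi], because [d/dx] is bounded from the norm [p + 1/2] to the norm [p].
    Inner products of representing sequences converge to the inner product of
    the completion, whatever the representatives ([sobolev_inner_cvg]), hence
    the inequality passes to the limit. *)

(** * Integration by parts for Schwartz functions *)

Lemma cvg0_le {R : realType} (v u : nat -> R) :
  (forall n, `|u n| <= v n) -> v n @[n --> \oo] --> 0 -> u n @[n --> \oo] --> 0.
Proof.
move=> uv /cvgr0Pnorm_lt v0; apply/cvgr0Pnorm_lt => e /v0.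
apply: filterS => n; apply: le_lt_trans.
by rewrite (le_trans (uv n))// ler_norm.
Qed.

Section integration.
Context {R : realType}.
Local Notation mu := (@lebesgue_measure R).
Implicit Types (F G : R -> R) (f g : schwartz R).

Lemma integrable_oneDsqrV :
  mu.-integrable [set: R] (EFin \o (fun x : R => (oneDsqr x)^-1)).
Proof.
have mf : measurable_fun [set: R] (fun x : R => (oneDsqr x)^-1).
  apply: continuous_measurable_fun; exact: continuous_oneDsqrV.
apply/integrableP; split; first exact/measurable_EFinP.
under eq_integral do rewrite /= ger0_norm ?invr_ge0 ?oneDsqr_ge0//.
rewrite ge0_symfun_integralT.
- rewrite -set_itvcy integral0y_oneDsqr -EFinM ltry//.
- by move=> x; rewrite invr_ge0.
- exact: continuous_oneDsqrV.
- by move=> x /=; rewrite /oneDsqr sqrrN.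
Qed.

Lemma decay_integrable F C : continuous F ->
  (forall x, `|F x| <= C * (oneDsqr x)^-1) ->
  mu.-integrable [set: R] (EFin \o F).
Proof.
move=> cF FC.
have iC : mu.-integrable [set: R] (fun x : R => (C%:E * ((oneDsqr x)^-1)%:E)%E).
  exact/(integrableZl measurableT)/integrable_oneDsqrV.
apply: le_integrable iC => //.
  by apply/measurable_EFinP; exact: continuous_measurable_fun.
by move=> x _ /=; rewrite lee_fin (le_trans (FC x))// ler_norm.
Qed.

(** The integral over [[-n, n]] is [F n - F (-n)], which tends to [0]; dominated
    convergence identifies its limit with the integral over the line. *)
Lemma integral_derive_eq0 (F G : R -> R) C :
  (forall x : R, is_derive x (1 : R) F (G x)) -> continuous G ->
  (forall x, `|F x| <= C * (oneDsqr x)^-1) ->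
  (forall x, `|G x| <= C * (oneDsqr x)^-1) ->
  \int[mu]_x G x = 0.
Proof.
move=> dF cG FC GC.
have cF : continuous F.
  move=> x; apply: differentiable_continuous; apply/derivable1_diffP.
  exact: (@ex_derive _ _ _ _ _ _ _ (dF x)).
pose I (n : nat) := `[- n.+1%:R, n.+1%:R]%classic : set R.
have GI n : (\int[mu]_(x in I n) (G x)%:E = (F n.+1%:R - F (- n.+1%:R))%:E)%E.
  rewrite (@continuous_FTC2 _ _ F) //.
  - have : (0 : R) < n.+1%:R by [].
    lra.
  - exact: continuous_subspaceT.
  - split => [x _||].
    + exact: (@ex_derive _ _ _ _ _ _ _ (dF x)).
    + exact/cvg_at_right_filter/cF.
    + exact/cvg_at_left_filter/cF.
  - by move=> x _; rewrite derive1E; exact: derive_val.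
have F0 (e : nat -> R) : (forall n, oneDsqr (e n) = oneDsqr (n.+1%:R)) ->
    F (e n) @[n --> \oo] --> (0 : R).
  move=> He; apply: (@cvg0_le _ (fun n => C * harmonic n)) => [n|].
    apply: (le_trans (FC _)); apply: ler_wpM2l.
      have := FC 0; rewrite /oneDsqr expr0n addr0 invr1 mulr1.
      by apply: le_trans.
    rewrite He lef_pV2 ?posrE ?oneDsqr_gt0// /oneDsqr.
    have : (1 : R) <= n.+1%:R by rewrite ler1n.
    nra.
  by rewrite -[X in _ --> X](mulr0 C); apply: cvgMl_tmp; exact: cvg_harmonic.
have cv1 : (\int[mu]_(x in I n) (G x)%:E)%E @[n --> \oo] --> (0 : \bar R)%E.
  under eq_fun do rewrite GI.
  apply/fine_cvgP; split; first exact: nearW.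
  rewrite -[X in _ --> X](subr0 (0:R)); apply: cvgB; apply: F0 => // n.
  by rewrite /oneDsqr sqrrN.
have mI n : measurable (I n) by exact: measurable_itv.
have mG : measurable_fun [set: R] (EFin \o G).
  by apply/measurable_EFinP; exact: continuous_measurable_fun.
have [|//||||_ _ cv2] := @dominated_convergence _ _ _ mu setT measurableT
  (fun n => (EFin \o G) \_ (I n)) (EFin \o G) (abse \o (EFin \o G)).
- by move=> n; apply/(measurable_restrictT _ (mI n)); exact: measurable_funTS.
- apply: aeW => x _; apply: cvg_near_cst.
  near=> n; rewrite patchE ifT// inE /I /= in_itv/=.
  have : `|x| <= n.+1%:R.
    rewrite (le_trans (ltW (archi_boundP (normr_ge0 x))))// ler_nat.
    by apply: leqW; near: n; exact: nbhs_infty_ge.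
  by rewrite ler_norml.
- exact/integrable_abse/(decay_integrable cG GC).
- apply: aeW => x n _ /=; rewrite patchE; case: ifPn => // _.
  by rewrite abse0.
have {}cv2 : (\int[mu]_(x in I n) (G x)%:E)%E @[n --> \oo] -->
    (\int[mu]_x (G x)%:E)%E.
  by move: cv2; under eq_fun do rewrite -integral_mkcond.
by rewrite /Rintegral -(cvg_lim _ cv2)// (cvg_lim _ cv1).
Unshelve. all: by end_near. Qed.

Lemma schwartz_is_derive f (x : R) : is_derive x (1 : R) f (schwartz_deriv f x).
Proof.
have /asboolP [df _] := schwartz_funP f.
by rewrite /= derive1E; apply: DeriveDef; first exact: (df 0%N).
Qed.

Lemma schwartz_continuous_fun f : continuous f.
Proof.
move=> x; apply: differentiable_continuous; apply/derivable1_diffP.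
exact: (@ex_derive _ _ _ _ _ _ _ (schwartz_is_derive f x)).
Qed.

Lemma schwartz_decay m f : exists C : R, forall x : R, `|x| ^+ m * `|f x| <= C.
Proof.
have /asboolP [_ /(_ m 0%N) [C HC]] := schwartz_funP f.
by exists C => x; rewrite -normrX -normrM; exact: HC.
Qed.

(** The majorant [1 / (1 + x^2)] is chosen because its integral is known. *)
Lemma schwartz_mul_decay f g :
  exists C : R, forall x : R, `|f x * g x| <= C * (oneDsqr x)^-1.
Proof.
have [A HA] := schwartz_decay 0 f; have [B HB] := schwartz_decay 2 f.
have [C HC] := schwartz_decay 0 g.
exists ((A + B) * C) => x; rewrite ler_pdivlMr ?oneDsqr_gt0//.
have {HA} := HA x; have {HB} := HB x; have {HC} := HC x.
rewrite normrM real_normK ?num_real// !expr0 !mul1r /oneDsqr.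
move=> gC fB fA; have := normr_ge0 (f x); have := normr_ge0 (g x) => g0 f0.
rewrite (_ : _ * _ = (`|f x| + x ^+ 2 * `|f x|) * `|g x|); last by ring.
apply: ler_pM => //; last exact: lerD.
by rewrite addr_ge0// mulr_ge0// sqr_ge0.
Qed.

Lemma schwartz_mul_continuous f g : continuous (fun x => f x * g x).
Proof.
by move=> x; apply: continuousM; exact: schwartz_continuous_fun.
Qed.

Lemma schwartz_mul_integrable f g :
  mu.-integrable [set: R] (EFin \o (fun x => f x * g x)).
Proof.
have [C HC] := schwartz_mul_decay f g.
exact: decay_integrable (@schwartz_mul_continuous f g) HC.
Qed.

Lemma l2_innerC (F G : R -> R) : l2_inner F G = l2_inner G F.
Proof. by rewrite /l2_inner; under eq_Rintegral do rewrite mulrC. Qed.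

Lemma l2_innerDl f g (h : schwartz R) : l2_inner (f + g) h = l2_inner f h + l2_inner g h.
Proof.
rewrite /l2_inner -RintegralD//; try exact: schwartz_mul_integrable.
by apply: eq_Rintegral => x _; rewrite -mulrDl.
Qed.

Lemma l2_innerZl a f (h : schwartz R) : l2_inner (a *: f) h = a * l2_inner f h.
Proof.
rewrite /l2_inner -RintegralZl//; last exact: schwartz_mul_integrable.
by apply: eq_Rintegral => x _; rewrite mulrA.
Qed.

Lemma l2_inner_ge0 f : 0 <= l2_inner f f.
Proof. by apply: Rintegral_ge0 => x _; rewrite -expr2 sqr_ge0. Qed.

(** From positivity of the squared norms of [f + g] and [f - g]; this crude form
    of the Cauchy-Schwarz inequality is enough to bound Hermite coefficients. *)
Lemma l2_inner_le f g : `|l2_inner f g| <= l2_inner f f + l2_inner g g.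
Proof.
have H a : 0 <= l2_inner f f + a * l2_inner f g *+ 2 + a ^+ 2 * l2_inner g g.
  have := l2_inner_ge0 (f + a *: g).
  rewrite l2_innerDl l2_innerZl ![l2_inner _ (f + _)]l2_innerC.
  rewrite !l2_innerDl !l2_innerZl (l2_innerC g f).
  by congr (_ <= _); ring.
have := H 1; have := H (-1); rewrite ler_norml.
have := l2_inner_ge0 f; have := l2_inner_ge0 g.
by move=> *; apply/andP; split; lra.
Qed.

Lemma l2_inner_deriv f g :
  l2_inner (schwartz_deriv f) g = - l2_inner f (schwartz_deriv g).
Proof.
apply/eqP; rewrite -addr_eq0; apply/eqP.
have [A HA] := schwartz_mul_decay f g.
have [B HB] := schwartz_mul_decay (schwartz_deriv f) g.
have [C HC] := schwartz_mul_decay f (schwartz_deriv g).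
rewrite /l2_inner -RintegralD//; try exact: schwartz_mul_integrable.
apply: (@integral_derive_eq0 (fun x => f x * g x) _ (`|A| + `|B| + `|C|)).
- move=> x.
  have := @is_deriveM _ _ f g x 1 _ _ (schwartz_is_derive f x)
    (schwartz_is_derive g x).
  by move=> /is_derive_eq; apply; rewrite addrC [X in X + _ = _]mulrC.
- have : continuous (fun x : R => schwartz_deriv f x * g x
      + f x * schwartz_deriv g x).
    by move=> x; apply: cvgD; exact: schwartz_mul_continuous.
  exact.
- move=> x; apply: le_trans (HA x) _; rewrite ler_wpM2r ?invr_ge0//.
  by rewrite -addrA (le_trans (ler_norm A))// lerDl addr_ge0.
- move=> x; apply: le_trans (ler_normD _ _) _.
  apply: le_trans (lerD (HB x) (HC x)) _.
  rewrite -mulrDl ler_wpM2r ?invr_ge0// -addrA.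
  by rewrite (le_trans (lerD (ler_norm B) (ler_norm C)))// lerDr.
Qed.

End integration.

(** * Hermite functions and Hermite coefficients *)

Section hermite.
Context {R : realType}.
Implicit Types (F G : R -> R) (f g : schwartz R) (p : {poly R}).

(** Coinductive criterion: if a class of rapidly decreasing functions is stable
    under derivation, no formula for the iterated derivatives is needed. *)
Lemma is_schwartz_closed (K : set (R -> R)) :
  (forall F, K F -> (forall x : R, derivable F x 1) /\ K (derive1 F)) ->
  (forall F m, K F -> exists C : R, forall x : R, `|x| ^+ m * `|F x| <= C) ->
  forall F, K F -> is_schwartz F.
Proof.
move=> dK bK F KF.
have KnF n : K (derive1n n F).
  by elim: n => // n IHn; rewrite derive1nS; exact: (dK _ IHn).2.
split=> [n|m n]; first exact: (dK _ (KnF n)).1.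
by have [C HC] := bK _ m (KnF n); exists C => x; rewrite normrM normrX.
Qed.

Lemma schwartz_mulx_subproof f : schwartz_pred (fun x => x * f x).
Proof.
apply/asboolP.
apply: (@is_schwartz_closed
  [set F | exists u v : schwartz R, F = fun x => x * u x + v x]).
- move=> _ [u [v ->]].
  have D (x : R) : is_derive x (1 : R) (fun x => x * u x + v x)
      (x * schwartz_deriv u x + (u x + schwartz_deriv v x)).
    have D1 := @is_deriveM _ _ id u x 1 _ _ (is_derive_id _ _)
      (schwartz_is_derive u x).
    have := @is_deriveD _ _ _ _ _ x 1 _ _ D1 (schwartz_is_derive v x).
    move=> /is_derive_eq; apply.
    by rewrite -addrA; congr (_ + (_ + _)); rewrite /GRing.scale/= mulr1.
  split; first by move=> x; exact: (@ex_derive _ _ _ _ _ _ _ (D x)).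
  exists (schwartz_deriv u), (u + schwartz_deriv v); apply/funext => x.
  by rewrite derive1E (@derive_val _ _ _ _ _ _ _ (D x)).
- move=> _ m [u [v ->]].
  have [A HA] := schwartz_decay m.+1 u; have [B HB] := schwartz_decay m v.
  exists (A + B) => x; apply: le_trans (lerD (HA x) (HB x)).
  rewrite exprSr -mulrA -mulrDr ler_wpM2l ?exprn_ge0// -normrM.
  exact: ler_normD.
- exists f, 0; apply/funext => x.
  by rewrite -[(0 : schwartz R) x]/(0 : R) addr0.
Qed.

Definition schwartz_mulx f : schwartz R := Schwartz (schwartz_mulx_subproof f).

Lemma l2_inner_mulx f g :
  l2_inner (schwartz_mulx f) g = l2_inner f (schwartz_mulx g).
Proof. by apply: eq_Rintegral => x _ /=; rewrite mulrAC mulrC mulrA mulrAC mulrC. Qed.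

Definition gauss_poly p (x : R) : R := expR (- (x ^+ 2 / 2)) * p.[x].

Lemma is_derive_gauss_poly p (x : R) :
  is_derive x (1 : R) (gauss_poly p) (gauss_poly (p^`() - 'X * p) x).
Proof.
rewrite /gauss_poly !hornerE.
have D1 : is_derive x (1 : R) (fun x : R => - (x ^+ 2 / 2)) (- x).
  by apply: is_derive_eq; rewrite /GRing.scale/=; field.
have D2 := @is_derive1_comp R expR (fun x : R => - (x ^+ 2 / 2)) _ _ _
  (is_derive_expR _) D1.
have := @is_deriveM _ _ _ _ x 1 _ _ D2 (is_derive_poly p x).
by move=> /is_derive_eq; apply; rewrite /GRing.scale/=; ring.
Qed.

(** The bound [1 + t <= exp t] at [t = y / (m+1)], raised to the power [m+1]. *)
Lemma pow_le_expR (m : nat) (y : R) : 0 <= y ->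
  y ^+ m.+1 <= m.+1%:R ^+ m.+1 * expR y.
Proof.
move=> y0; have m0 : (0 : R) < m.+1%:R by rewrite ltr0n.
have H : y / m.+1%:R <= expR (y / m.+1%:R).
  by apply: le_trans (expR_ge1Dx _); rewrite lerDr.
rewrite -[in leLHS](divfK (lt0r_neq0 m0) y) exprMn mulrC ler_pM2l ?exprn_gt0//.
rewrite -[in leRHS](divfK (lt0r_neq0 m0) y) [in leRHS]mulrC expRM_natl.
apply: lerXn2r => //; rewrite nnegrE ?expR_ge0// divr_ge0// ltW//.
Qed.

Lemma gauss_pow_bound (m : nat) :
  exists C : R, forall x : R, `|x| ^+ m * expR (- (x ^+ 2 / 2)) <= C.
Proof.
exists (1 + 2 ^+ m.+1 * m.+1%:R ^+ m.+1) => x.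
have x0 : 0 <= x ^+ 2 / 2 by rewrite divr_ge0// sqr_ge0.
rewrite expRN ler_pdivrMr ?expR_gt0//.
have e1 : 1 <= expR (x ^+ 2 / 2) by have := expR_ge1Dx (x ^+ 2 / 2); lra.
have := pow_le_expR m x0; set e := expR _ in e1 *.
rewrite expr_div_n ler_pdivrMr ?exprn_gt0// => H.
rewrite mulrDl mul1r.
have [x1|x1] := leP `|x| 1.
  apply: (@le_trans _ _ 1); first by rewrite exprn_ile1.
  rewrite (le_trans e1)// lerDl !mulr_ge0 ?exprn_ge0//.
  exact: le_trans e1.
apply: (@le_trans _ _ (`|x| ^+ (2 * m.+1))).
  by rewrite ler_weXn2l// ?(ltW x1)// mul2n -addnn addSn leqW// leq_addr.
rewrite exprM real_normK ?num_real// (le_trans H)//.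
rewrite mulrAC [2 ^+ _ * _]mulrC lerDr.
exact: le_trans e1.
Qed.

Lemma gauss_poly_bound p (m : nat) :
  exists C : R, forall x : R, `|x| ^+ m * `|gauss_poly p x| <= C.
Proof.
elim/poly_ind: p m => [|p c IHp] m.
  by exists 0 => x; rewrite /gauss_poly horner0 mulr0 normr0 mulr0.
have [A HA] := IHp m.+1; have [B HB] := gauss_pow_bound m.
exists (A + `|c| * B) => x.
have -> : gauss_poly (p * 'X + c%:P) x
    = x * gauss_poly p x + c * expR (- (x ^+ 2 / 2)).
  by rewrite /gauss_poly !hornerE/=; ring.
apply: le_trans (ler_wpM2l (exprn_ge0 _ (normr_ge0 x)) (ler_normD _ _)) _.
rewrite mulrDr lerD//.
  by rewrite normrM mulrA -exprSr.
rewrite normrM mulrCA ler_wpM2l// ger0_norm ?expR_ge0//.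
Qed.

Lemma gauss_poly_schwartz p : is_schwartz (gauss_poly p).
Proof.
apply: (@is_schwartz_closed (range gauss_poly)); last by exists p.
- move=> _ [q _ <-]; split.
    by move=> x; exact: (@ex_derive _ _ _ _ _ _ _ (is_derive_gauss_poly q x)).
  exists (q^`() - 'X * q) => //; apply/funext => x.
  by rewrite derive1E (@derive_val _ _ _ _ _ _ _ (is_derive_gauss_poly q x)).
- by move=> _ m [q _ <-]; exact: gauss_poly_bound.
Qed.

Definition hermite_scale (k : nat) : R :=
  (Num.sqrt (2 ^+ k * k`!%:R * Num.sqrt pi))^-1.

Lemma hermite_funE k :
  hermite_fun k = gauss_poly (hermite_scale k *: hermite_poly k) :> (R -> R).
Proof.
by apply/funext => x; rewrite /hermite_fun /gauss_poly /hermite_scale hornerZ; ring.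
Qed.

Lemma hermite_schwartz_subproof k : schwartz_pred (hermite_fun k : R -> R).
Proof. by apply/asboolP; rewrite hermite_funE; exact: gauss_poly_schwartz. Qed.

Definition hermite_schwartz k : schwartz R :=
  Schwartz (hermite_schwartz_subproof k).

(** Matrix entries of [d/dx] in the Hermite basis. *)
Definition ladder (k : nat) : R := Num.sqrt (k%:R / 2).

Lemma ladder0 : ladder 0 = 0.
Proof. by rewrite /ladder mul0r sqrtr0. Qed.

Lemma ladder_ge0 k : 0 <= ladder k. Proof. exact: sqrtr_ge0. Qed.

Lemma ladder_gt0 k : 0 < ladder k.+1.
Proof. by rewrite sqrtr_gt0 divr_gt0. Qed.

Lemma sqr_ladder k : ladder k ^+ 2 = k%:R / 2.
Proof. by rewrite sqr_sqrtr// divr_ge0. Qed.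

Lemma hermite_scaleS k :
  hermite_scale k = 2 * ladder k.+1 * hermite_scale k.+1.
Proof.
have p0 := pi_gt0 R.
have E : 2 * ladder k.+1 = Num.sqrt (2 * k.+1%:R).
  rewrite -[2 in LHS]ger0_norm// -sqrtr_sqr -sqrtrM ?sqr_ge0//.
  by congr Num.sqrt; field.
rewrite E /hermite_scale.
have -> : 2 ^+ k.+1 * k.+1`!%:R * Num.sqrt (pi : R)
    = (2 * k.+1%:R) * (2 ^+ k * k`!%:R * Num.sqrt pi).
  by rewrite factS natrM exprS; ring.
rewrite (@sqrtrM _ (2 * k.+1%:R)) ?mulr_ge0// invfM mulrA divff ?mul1r//.
Qed.

Lemma hermite_poly_deriv k :
  (hermite_poly k.+1)^`() = (2 * k.+1%:R) *: hermite_poly k :> {poly R}.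
Proof.
elim: k => [|k IHk].
  by rewrite /= -!polyC1 mulr1 !(derivC, subr0) derivM derivX derivC mul0r add0r
    !mulr1 -mul_polyC -polyCM mulr1.
rewrite [hermite_poly k.+2]/= -/(hermite_poly k.+1) derivB derivM IHk derivZ.
rewrite derivM derivX derivC mul0r add0r mulr1.
have -> : (hermite_poly k)^`() = 2%:P * 'X * hermite_poly k - hermite_poly k.+1
  :> {poly R} by rewrite /=; ring.
by rewrite -!mul_polyC -[k.+2%:R]natr1 !(polyCM, polyCD) polyC1; ring.
Qed.

(** The creation operator [x - d/dx]; this is the recurrence that defines the
    Hermite polynomials. *)
Lemma hermite_raise k :
  schwartz_mulx (hermite_schwartz k) - schwartz_deriv (hermite_schwartz k)
  = (2 * ladder k.+1) *: hermite_schwartz k.+1.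
Proof.
apply/val_inj/funext => x.
rewrite /= -[LHS]/(x * hermite_fun k x - derive1 (hermite_fun k) x).
rewrite -[RHS]/((2 * ladder k.+1) * hermite_fun k.+1 x).
rewrite derive1E !hermite_funE.
rewrite (@derive_val _ _ _ _ _ _ _ (is_derive_gauss_poly _ x)).
by rewrite [hermite_scale k]hermite_scaleS /gauss_poly !(hornerE, derivZ)/=; ring.
Qed.

(** The annihilation operator [x + d/dx]; it kills the Gaussian, and acts on the
    polynomial factor as the plain derivative. For [k = 0] the value of [k.-1]
    is harmless since [ladder 0 = 0]; this convention is used throughout. *)
Lemma hermite_lower k :
  schwartz_mulx (hermite_schwartz k) + schwartz_deriv (hermite_schwartz k)
  = (2 * ladder k) *: hermite_schwartz k.-1.
Proof.
apply/val_inj/funext => x.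
rewrite /= -[LHS]/(x * hermite_fun k x + derive1 (hermite_fun k) x).
rewrite -[RHS]/((2 * ladder k) * hermite_fun k.-1 x).
rewrite derive1E !hermite_funE.
rewrite (@derive_val _ _ _ _ _ _ _ (is_derive_gauss_poly _ x)).
case: k => [|k]; first have -> : hermite_poly 0 = 1%:P :> {poly R} by rewrite polyC1.
  by rewrite ladder0 /gauss_poly derivZ derivC !hornerE/=; ring.
rewrite [hermite_scale k]hermite_scaleS /gauss_poly derivZ hermite_poly_deriv.
rewrite /= !hornerE/=.
have := sqr_ladder k.+1; rewrite -natr1 => E.
have -> : k%:R + 1 = 2 * ladder k.+1 ^+ 2 by rewrite E; field.
ring.
Qed.

Definition hermite_coef (F : R -> R) (k : nat) : R := l2_inner F (hermite_fun k).

Lemma hermite_coefE f k : hermite_coef f k = l2_inner f (hermite_schwartz k).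
Proof. by []. Qed.

Lemma hermite_coef_comb a f g k :
  hermite_coef (a *: f + g) k = a * hermite_coef f k + hermite_coef g k.
Proof. by rewrite (hermite_coefE (_ + _)) l2_innerDl l2_innerZl. Qed.

Lemma l2_innerDr f g h : l2_inner f (g + h) = l2_inner f g + l2_inner f h.
Proof. by rewrite ![l2_inner f _]l2_innerC l2_innerDl. Qed.

Lemma l2_innerZr a f g : l2_inner f (a *: g) = a * l2_inner f g.
Proof. by rewrite ![l2_inner f _]l2_innerC l2_innerZl. Qed.

Lemma hermite_deriv k :
  schwartz_deriv (hermite_schwartz k) =
  ladder k *: hermite_schwartz k.-1 - ladder k.+1 *: hermite_schwartz k.+1.
Proof.
have H1 := hermite_raise k; have H2 := hermite_lower k.
apply: (@scalerI _ _ 2) => //.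
rewrite scalerBr !scalerA -H1 -H2 opprB [_ + (_ - _)]addrC addrA.
by rewrite subrK scaler_nat mulr2n.
Qed.

Lemma hermite_coef_deriv f k :
  hermite_coef (schwartz_deriv f) k
  = ladder k.+1 * hermite_coef f k.+1 - ladder k * hermite_coef f k.-1.
Proof.
rewrite !hermite_coefE l2_inner_deriv hermite_deriv.
by rewrite -scaleNr l2_innerDr !l2_innerZr; ring.
Qed.

Definition schwartz_lower f : schwartz R := schwartz_mulx f + schwartz_deriv f.

Lemma hermite_coef_lower f k :
  hermite_coef (schwartz_lower f) k = 2 * ladder k.+1 * hermite_coef f k.+1.
Proof.
rewrite !hermite_coefE /schwartz_lower l2_innerDl l2_inner_mulx l2_inner_deriv.
rewrite -l2_innerZr -hermite_raise -[- schwartz_deriv _]scaleN1r.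
by rewrite l2_innerDr l2_innerZr mulN1r.
Qed.

(** Creation and annihilation are adjoint to each other, so that
    [2 (k+1) |h_(k+1)|^2 = 2 (k+1) |h_k|^2]; the value of the Gaussian integral
    is not involved. *)
Lemma hermite_l2_const k :
  l2_inner (hermite_schwartz k) (hermite_schwartz k)
  = l2_inner (hermite_schwartz 0) (hermite_schwartz 0).
Proof.
elim: k => // k <-; have s0 := ladder_gt0 k.
apply: (@mulfI _ (2 * ladder k.+1)); first by rewrite lt0r_neq0// mulr_gt0.
rewrite -hermite_coefE -hermite_coef_lower /schwartz_lower hermite_lower.
by rewrite hermite_coefE l2_innerZl.
Qed.

Lemma hermite_coef_bounded f : exists C : R, forall k, `|hermite_coef f k| <= C.
Proof.
exists (l2_inner f f + l2_inner (hermite_schwartz 0) (hermite_schwartz 0)) => k.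
by rewrite hermite_coefE -(hermite_l2_const k) l2_inner_le.
Qed.

Definition rapid (a : nat -> R) : Prop :=
  forall N : nat, exists C : R, forall k, `|a k| * k.+1%:R ^+ N <= C.

(** Each use of the annihilation operator gains one factor [sqrt k]: the
    coefficients of [schwartz_lower f] are those of [f] times
    [2 * ladder k.+1], shifted by one. *)
Lemma hermite_coef_ladder_decay f (N : nat) :
  exists C : R, forall k, `|hermite_coef f k| * ladder k.+1 ^+ N <= C.
Proof.
elim: N f => [|N IHN] f.
  have [C HC] := hermite_coef_bounded f.
  by exists C => k; rewrite expr0 mulr1.
have [C HC] := IHN (schwartz_lower f).
exists (Num.max (`|hermite_coef f 0| * ladder 1 ^+ N.+1) (2 ^+ N * C)) => -[|k].
  by rewrite le_max lexx.
rewrite le_max; apply/orP; right.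
have s1 := ladder_gt0 k; have s2 := ladder_ge0 k.+2.
have s12 : ladder k.+2 <= 2 * ladder k.+1.
  rewrite -ler_sqr ?nnegrE ?mulr_ge0 ?(ltW s1)// exprMn !sqr_ladder.
  by rewrite -[k.+2%:R]natr1 -[k.+1%:R]natr1; have := ler0n R k; lra.
apply: le_trans (ler_wpM2l (exprn_ge0 N (ler0n _ 2)) (HC k)).
rewrite hermite_coef_lower !normrM [`|2|]ger0_norm// (ger0_norm (ltW s1)).
rewrite [leRHS](_ : _ = `|hermite_coef f k.+1| * (2 * ladder k.+1) ^+ N.+1).
  by rewrite ler_wpM2l// lerXn2r// nnegrE mulr_ge0// ltW.
by rewrite exprMn !exprS; ring.
Qed.

Lemma hermite_coef_rapid f : rapid (hermite_coef f).
Proof.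
move=> N; have [C HC] := hermite_coef_ladder_decay f (2 * N).
exists (2 ^+ N * C) => k.
apply: le_trans (ler_wpM2l (exprn_ge0 N (ler0n _ 2)) (HC k)).
rewrite exprM sqr_ladder mulrCA -exprMn mulrC.
by rewrite [2 * _]mulrC divfK// mulrC.
Qed.
End hermite.

(** * Rapidly decreasing sequences and their sums *)

Section rapid_sequences.
Context {R : realType}.
Implicit Types (a b u v : nat -> R) (m : nat -> R).

Definition temperate m : Prop :=
  exists (N : nat) (C : R), forall k, `|m k| <= C * k.+1%:R ^+ N.

Lemma rapid_temperate a : rapid a -> temperate a.
Proof.
move=> /(_ 0%N) [C HC]; exists 0%N, C => k.
by have := HC k; rewrite !expr0 !mulr1.
Qed.

Lemma rapidM m a : temperate m -> rapid a -> rapid (fun k => m k * a k).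
Proof.
move=> [M [A HA]] ra N; have [C HC] := ra (M + N)%N; exists (`|A| * C) => k.
have k0 : (0 : R) <= k.+1%:R by [].
rewrite normrM; apply: le_trans (ler_wpM2l (normr_ge0 A) (HC k)).
rewrite exprD -mulrA [leRHS](_ : _ = `|A| * k.+1%:R ^+ M
  * (`|a k| * k.+1%:R ^+ N)); last by ring.
rewrite ler_wpM2r ?mulr_ge0 ?exprn_ge0//.
by rewrite (le_trans (HA k))// ler_wpM2r ?exprn_ge0// ler_norm.
Qed.

Lemma rapidMl m a : rapid a -> temperate m -> rapid (fun k => a k * m k).
Proof. by move=> ra tm; under eq_fun do rewrite mulrC; exact: rapidM. Qed.

Lemma rapidD a b : rapid a -> rapid b -> rapid (fun k => a k + b k).
Proof.
move=> ra rb N; have [A HA] := ra N; have [B HB] := rb N.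
exists (A + B) => k; apply: le_trans (lerD (HA k) (HB k)).
by rewrite -mulrDl ler_wpM2r ?exprn_ge0// ler_normD.
Qed.

Lemma rapidN a : rapid a -> rapid (fun k => - a k).
Proof.
by move=> ra N; have [C HC] := ra N; exists C => k; rewrite normrN.
Qed.

(** The constant [4] is the largest shift that occurs in the estimates. *)
Lemma rapid_reindex a (phi : nat -> nat) : rapid a ->
  (forall k, k <= phi k + 4)%N -> rapid (fun k => a (phi k)).
Proof.
move=> ra Hphi N; have [C HC] := ra N; exists (C * 5 ^+ N) => k.
apply: le_trans (ler_wpM2r (exprn_ge0 N (ler0n R 5)) (HC (phi k))).
rewrite -mulrA -exprMn ler_wpM2l// lerXn2r ?nnegrE//.
by rewrite -natrM ler_nat; have := Hphi k; lia.
Qed.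

Lemma temperate_cst (c : R) : temperate (fun=> c).
Proof. by exists 0%N, `|c| => k; rewrite mulr1. Qed.

Lemma temperate_le m (N : nat) (C : R) :
  (forall k, `|m k| <= C * k.+1%:R ^+ N) -> temperate m.
Proof. by move=> H; exists N, C. Qed.

Lemma temperateM m n :
  temperate m -> temperate n -> temperate (fun k => m k * n k).
Proof.
move=> [M [A HA]] [N [B HB]]; exists (M + N)%N, (A * B) => k.
rewrite normrM; apply: le_trans (ler_pM _ _ (HA k) (HB k)) _ => //.
by rewrite exprD le_eqVlt; apply/orP; left; apply/eqP; ring.
Qed.

Lemma temperateN m : temperate m -> temperate (fun k => - m k).
Proof. by move=> [M [A HA]]; exists M, A => k; rewrite normrN. Qed.

Lemma temperateD m n :
  temperate m -> temperate n -> temperate (fun k => m k + n k).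
Proof.
move=> [M [A HA]] [N [B HB]]; exists (M + N)%N, (`|A| + `|B|) => k.
apply: le_trans (ler_normD _ _) _; rewrite mulrDl.
have k1 : (1 : R) <= k.+1%:R by rewrite ler1n.
have k0 : (0 : R) <= k.+1%:R by [].
apply: lerD.
  apply: le_trans (HA k) _; apply: (@le_trans _ _ (`|A| * k.+1%:R ^+ M)).
    by rewrite ler_wpM2r ?exprn_ge0// ler_norm.
  by rewrite ler_wpM2l// ler_weXn2l// leq_addr.
apply: le_trans (HB k) _; apply: (@le_trans _ _ (`|B| * k.+1%:R ^+ N)).
  by rewrite ler_wpM2r ?exprn_ge0// ler_norm.
by rewrite ler_wpM2l// ler_weXn2l// leq_addl.
Qed.

Lemma temperate_reindex m (phi : nat -> nat) : temperate m ->
  (forall k, phi k <= k + 4)%N -> temperate (fun k => m (phi k)).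
Proof.
move=> [N [C HC]] Hphi; exists N, (`|C| * 5 ^+ N) => k.
apply: le_trans (HC _) _; apply: (@le_trans _ _ (`|C| * (phi k).+1%:R ^+ N)).
  by rewrite ler_wpM2r ?exprn_ge0// ler_norm.
rewrite -mulrA -exprMn ler_wpM2l// lerXn2r ?nnegrE//.
by rewrite -natrM ler_nat; have := Hphi k; lia.
Qed.

Definition tsum u : R := limn (series u).

Lemma rapid_cvg0 u : rapid u -> u n @[n --> \oo] --> 0.
Proof.
move=> /(_ 1%N) [C HC].
apply: (@cvg0_le _ (fun n => C * harmonic n)) => [n|].
  by rewrite ler_pdivlMr//; have := HC n; rewrite expr1.
by rewrite -[X in _ --> X](mulr0 C); apply: cvgMl_tmp; exact: cvg_harmonic.
Qed.

Lemma nonneg_summable v (M : R) : (forall k, 0 <= v k) ->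
  (forall n, series v n <= M) -> cvgn (series v).
Proof.
move=> v0 HM; apply: nondecreasing_is_cvgn.
  by apply: nondecreasing_series => k _ _; exact: v0.
by exists M => _ [n _ <-]; exact: HM.
Qed.

Lemma le_series_tsum v n : (forall k, 0 <= v k) -> cvgn (series v) ->
  series v n <= tsum v.
Proof.
move=> v0 cv; apply: nondecreasing_cvgn_le => //.
by apply: nondecreasing_series => k _ _; exact: v0.
Qed.

Lemma tsum_ge0 v : (forall k, 0 <= v k) -> cvgn (series v) -> 0 <= tsum v.
Proof.
by move=> v0 cv; have := le_series_tsum 0 v0 cv; rewrite seriesEnat/= big_geq.
Qed.

Lemma rapid_summable u : rapid u -> cvgn (series u).
Proof.
move=> /(_ 2%N) [C HC]; apply: normed_cvg.
have C0 : 0 <= C by apply: le_trans (HC 0%N); rewrite mulr_ge0.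
(* 1 / (k+1)^2 is at most the telescoping 2 (1 / (k+1) - 1 / (k+2)) *)
have S n : series (fun k => `|u k|) n <= 2 * C * (1 - n.+1%:R^-1).
  elim: n => [|n IHn]; first by rewrite seriesEnat/= big_nil invr1 subrr mulr0.
  rewrite seriesSr -[X in X + _]/(series (fun k => `|u k|) n).
  apply: le_trans (lerD IHn (lexx _)) _.
  have n0 : (0 : R) <= n%:R by [].
  rewrite -lerBrDl -mulrBr [1 - _ - _](_ : _ = n.+1%:R^-1 - n.+2%:R^-1); last by ring.
  have n1 : 0 < n%:R + 1 :> R by rewrite ltr_wpDl.
  have n2 : 0 < n%:R + 1 + 1 :> R by rewrite ltr_wpDl// ltW.
  have := HC n; rewrite -ler_pdivlMr ?exprn_gt0// => /le_trans; apply.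
  rewrite -[n.+2%:R]natr1 -[n.+1%:R]natr1 expr2 -subr_ge0.
  rewrite (_ : _ - _ = C * (n%:R / ((n%:R + 1) ^+ 2 * (n%:R + 1 + 1)))).
    by rewrite mulr_ge0// divr_ge0// mulr_ge0 ?exprn_ge0 ?ltW.
  by field; rewrite !lt0r_neq0.
apply: (@nonneg_summable _ (2 * C)) => [n|n]; first exact: normr_ge0.
apply: le_trans (S n) _; rewrite ler_piMr ?mulr_ge0// gerBl.
Qed.

Lemma tsumE u (l : R) : series u n @[n --> \oo] --> l -> tsum u = l.
Proof. by move=> ?; exact: cvg_lim. Qed.

Lemma tsumD u v : cvgn (series u) -> cvgn (series v) ->
  tsum (fun k => u k + v k) = tsum u + tsum v.
Proof. exact: lim_seriesD. Qed.

Lemma tsumZ (c : R) u : cvgn (series u) ->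
  tsum (fun k => c * u k) = c * tsum u.
Proof. exact: lim_seriesZ. Qed.

Lemma le_tsum u v : cvgn (series u) -> cvgn (series v) ->
  (forall k, u k <= v k) -> tsum u <= tsum v.
Proof. by move=> *; exact: lim_series_le. Qed.

Lemma tsum_telescope T : T 0%N = 0 -> T n @[n --> \oo] --> 0 ->
  tsum (fun k => T k.+1 - T k) = 0.
Proof.
move=> T0 cT; apply: tsumE.
rewrite (_ : series _ = T)//; apply/funext => n.
by rewrite seriesEnat/= telescope_sumr// T0 subr0.
Qed.

Lemma tsumS u : cvgn (series u) -> tsum u = u 0%N + tsum (fun k => u k.+1).
Proof.
move=> cu.
have E n : series u n.+1 = u 0%N + series (fun k => u k.+1) n.
  by rewrite !seriesEnat/= big_nat_recl.
have c1 : series u n.+1 @[n --> \oo] --> tsum u by rewrite cvg_shiftS; exact: cu.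
apply: (@addrI _ (- u 0%N)); rewrite addKr addrC; apply/esym/tsumE.
rewrite (_ : series _ = fun n => series u n.+1 - u 0%N).
  by apply: cvgB => //; exact: cvg_cst.
by apply/funext => n; rewrite E addrC addKr.
Qed.

Lemma rapidS u : rapid u -> rapid (fun k => u k.+1).
Proof. by move=> ru; apply: (rapid_reindex ru) => k; lia. Qed.

Lemma tsum_shift_le v (j : nat) : (forall k, 0 <= v k) -> rapid v ->
  tsum (fun k => v (k + j)%N) <= tsum v.
Proof.
move=> v0 rv; elim: j => [|j IHj]; first by under eq_fun do rewrite addn0.
have rj : rapid (fun k => v (k + j)%N) by apply: (rapid_reindex rv) => k; lia.
apply: le_trans IHj; under eq_fun do rewrite addnS -addSn.
by rewrite [leRHS]tsumS ?lerDr//; exact: rapid_summable.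
Qed.

Lemma ladder_temperate : temperate (@ladder R).
Proof.
apply: (@temperate_le _ 1 1) => k; rewrite expr1 mul1r ger0_norm ?ladder_ge0//.
rewrite -ler_sqr ?nnegrE ?ladder_ge0// sqr_ladder.
rewrite -natr1 ler_pdivrMr//; have := ler0n R k; set x := k%:R => x0.
have := sqr_ge0 x; rewrite !expr2; lra.
Qed.

Lemma eq_tsum u v : u =1 v -> tsum u = tsum v.
Proof. by move=> /funext ->. Qed.

(** The derivative on Hermite coefficients. *)
Definition dstep a (k : nat) : R :=
  ladder k.+1 * a k.+1 - ladder k * a k.-1.
End rapid_sequences.

Ltac nat_bound := let k := fresh "k" in move=> k; lia.

(** [temper] and [rapidly] prove growth and decay of explicit expressions,
    following their syntax; a product is rapidly decreasing if one factor is and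
    the other is temperate. *)
Ltac temper := first [assumption | lazymatch goal with
  | |- temperate (fun _ => ?c) => exact (temperate_cst c)
  | |- temperate (fun k => ladder k) => exact ladder_temperate
  | |- temperate (@ladder _) => exact ladder_temperate
  | |- temperate (fun k => (@?x k) * (@?y k)) =>
      apply: (@temperateM _ x y); temper
  | |- temperate (fun k => (@?x k) + (@?y k)) =>
      apply: (@temperateD _ x y); temper
  | |- temperate (fun k => - (@?x k)) => apply: (@temperateN _ x); temper
  | |- temperate (fun k => ?x (@?phi k)) =>
      apply: (@temperate_reindex _ x phi); [temper | nat_bound]
  end ].
Ltac rapidly := first [assumption | lazymatch goal with
  | |- rapid (fun k => (@?x k) * (@?y k)) => first
    [ apply: (@rapidM _ x y); [solve [temper] | solve [rapidly]]
    | apply: (@rapidMl _ x y); [solve [rapidly] | solve [temper]]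
    | apply: (@rapidM _ x y);
        [apply: rapid_temperate; solve [rapidly] | solve [rapidly]] ]
  | |- rapid (fun k => (@?x k) + (@?y k)) => apply: (@rapidD _ x y); rapidly
  | |- rapid (fun k => - (@?x k)) => apply: (@rapidN _ x); rapidly
  | |- rapid (fun k => ?x (@?phi k)) =>
      apply: (@rapid_reindex _ x phi); [rapidly | nat_bound]
  end ].

Section weighted.
Context {R : realType}.
Implicit Types (a b u v w : nat -> R).

Lemma rapid_dstep a : rapid a -> rapid (dstep a).
Proof. move=> ra; rewrite /dstep; rapidly. Qed.

(** [dstep u * v + u * dstep v] is the difference of
    [T k = s k (u k v (k-1) + u (k-1) v k)] and vanishes at both ends. *)
Lemma dstep_anti u v : rapid u -> rapid v ->
  tsum (fun k => dstep u k * v k) = - tsum (fun k => u k * dstep v k).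
Proof.
move=> ru rv; have rDu := rapid_dstep ru; have rDv := rapid_dstep rv.
apply/eqP; rewrite -addr_eq0 -tsumD; [|apply: rapid_summable; rapidly..].
pose T k := ladder k * (u k * v k.-1 + u k.-1 * v k).
rewrite (@eq_tsum _ _ (fun k => T k.+1 - T k)); last first.
  by move=> k; rewrite /T /dstep /=; ring.
apply/eqP/tsum_telescope; first by rewrite /T ladder0 mul0r.
apply: rapid_cvg0; rewrite /T; rapidly.
Qed.

(** Symbol-type estimates satisfied by the powers of [2 k + 1]: each difference
    gains one factor [1 / k]. The second difference has step [2] because it
    arises from [D^2], which shifts indices by [-2], [0] or [2]. *)
Record slow_weight w (K : R) : Prop := SlowWeight {
  slow_temperate : temperate w ;
  slow_gt0 : forall k, 0 < w k ;
  slow_ratio : forall k j, (j <= 4)%N -> w k <= K * w (k + j)%N ;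
  slow_diff1 : forall k j, (j <= 4)%N ->
    `|w (k + j)%N - w k| * (2 * k%:R + 1) <= K * w k ;
  slow_diff2 : forall k,
    `|w k.+4 - 2 * w k.+2 + w k| * (2 * k%:R + 1) ^+ 2 <= K * w k }.

Definition weighted_sqnorm w a : R := tsum (fun k => w k * (a k * a k)).

(** By [2 x y <= x^2 + y^2], and because [w k] is comparable to [w (k + i)] and
    [w (k + j)]. *)
Lemma shifted_form_le w K (C : R) m a (i j : nat) : slow_weight w K ->
  (forall k, `|m k| <= C * w k) -> rapid a -> (i <= 4)%N -> (j <= 4)%N ->
  tsum (fun k => m k * (a (k + i)%N * a (k + j)%N)) <= C * K * weighted_sqnorm w a.
Proof.
move=> [tw w0 wr _ _] mw ra i4 j4.
have C0 : 0 <= C.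
  by have := le_trans (normr_ge0 _) (mw 0%N); rewrite pmulr_lge0.
have K0 : 0 <= K.
  have := wr 0%N 0%N isT; rewrite -ler_pdivrMr// divff ?lt0r_neq0//.
  exact: le_trans.
have tm : temperate m.
  have [N [A HA]] := tw; exists N, (C * A) => k.
  apply: le_trans (mw k) _; rewrite -mulrA ler_wpM2l//.
  by apply: le_trans (HA k); exact: ler_norm.
have rv : rapid (fun k => w k * (a k * a k)) by rapidly.
have rvj l : (l <= 4)%N ->
  rapid (fun k => w (k + l)%N * (a (k + l)%N * a (k + l)%N)).
  by move=> l4; apply: (rapid_reindex rv) => k; lia.
have v0 k : 0 <= w k * (a k * a k).
  by rewrite mulr_ge0 ?(ltW (w0 k))// -expr2 sqr_ge0.
have raj l : (l <= 4)%N -> rapid (fun k => a (k + l)%N).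
  by move=> l4; apply: (rapid_reindex ra) => k; lia.
have ri := raj _ i4; have rj := raj _ j4.
have rvi := rvj _ i4; have rvj' := rvj _ j4.
apply: (@le_trans _ _ (tsum (fun k => C * K / 2 *
   (w (k + i)%N * (a (k + i)%N * a (k + i)%N)
   + w (k + j)%N * (a (k + j)%N * a (k + j)%N))))).
  apply: le_tsum; try (apply: rapid_summable; rapidly).
  move=> k; apply: le_trans (ler_norm _) _; rewrite normrM.
  apply: le_trans (ler_wpM2r (normr_ge0 _) (mw k)) _.
  have Hi := wr k i i4; have Hj := wr k j j4.
  rewrite -!mulrA ler_wpM2l//.
  have xy : `|a (k + i)%N * a (k + j)%N| <=
      (a (k + i)%N * a (k + i)%N + a (k + j)%N * a (k + j)%N) / 2.
    rewrite ler_norml; apply/andP; split.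
      by have := sqr_ge0 (a (k + i)%N + a (k + j)%N); nra.
    by have := sqr_ge0 (a (k + i)%N - a (k + j)%N); nra.
  apply: le_trans (ler_wpM2l (ltW (w0 k)) xy) _.
  have := ler_wpM2r (sqr_ge0 (a (k + i)%N)) Hi.
  have := ler_wpM2r (sqr_ge0 (a (k + j)%N)) Hj.
  rewrite !expr2; lra.
rewrite tsumZ; last by apply: rapid_summable; rapidly.
rewrite tsumD; [|apply: rapid_summable; rapidly..].
have := tsum_shift_le i v0 rv; have := tsum_shift_le j v0 rv.
rewrite -/(weighted_sqnorm w a) => Hj Hi.
rewrite -!mulrA ler_wpM2l// ler_wpM2l// ler_pdivrMl//; lra.
Qed.

(** * The commutator estimates *)

Section estimate.
Variables (w : nat -> R) (K : R).
Hypothesis sw : slow_weight w K.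

Lemma slow_ge0 k : 0 <= w k. Proof. by rewrite ltW// (slow_gt0 sw). Qed.

Lemma slow_const_ge1 : 1 <= K.
Proof.
have := slow_ratio sw 0 (leq0n 4).
by rewrite addn0 -ler_pdivrMr ?divff ?lt0r_neq0 ?(slow_gt0 sw).
Qed.

Lemma ladder_ladder_le k i j : (i <= 4)%N -> (j <= 4)%N ->
  ladder (k + i) * ladder (k + j) <= 2 * (2 * k%:R + 1) :> R.
Proof.
move=> i4 j4.
have L (l : nat) : (l <= 4)%N -> ladder (k + l) ^+ 2 <= 2 * (2 * k%:R + 1) :> R.
  move=> l4; rewrite sqr_ladder natrD.
  have : l%:R <= 4 :> R by rewrite (ler_nat _ l 4).
  have := ler0n R k; lra.
have := L _ i4; have := L _ j4.
have := sqr_ge0 (ladder (k + i) - ladder (k + j) : R).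
rewrite !expr2; lra.
Qed.

(** Two ladder factors are [O(k)] and cost exactly what a first difference of
    the weight gains. *)
Lemma ladder_diff1_le k i j l m : (i <= 4)%N -> (j <= 4)%N ->
  (l <= 4)%N -> (m <= 4)%N ->
  `|ladder (k + i) * ladder (k + j) * (w (k + l)%N - w (k + m)%N)|
  <= 4 * K * w k.
Proof.
move=> i4 j4 l4 m4; have Hl := slow_diff1 sw k l4; have Hm := slow_diff1 sw k m4.
rewrite normrM ger0_norm ?mulr_ge0 ?ladder_ge0//.
apply: le_trans (ler_wpM2r (normr_ge0 _) (ladder_ladder_le k i4 j4)) _.
have : `|w (k + l)%N - w (k + m)%N| <= `|w (k + l)%N - w k| + `|w (k + m)%N - w k|.
  rewrite (_ : w (k + l)%N - w (k + m)%N
    = (w (k + l)%N - w k) - (w (k + m)%N - w k)); last by ring.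
  exact: ler_normB.
have x0 : 0 <= 2 * k%:R + 1 :> R by rewrite addr_ge0// mulr_ge0.
move=> /(ler_wpM2l x0); rewrite mulrDr; lra.
Qed.

Lemma temperate_dominated (C : R) m :
  (forall k, `|m k| <= C * w k) -> temperate m.
Proof.
move=> mw; have [N [A HA]] := slow_temperate sw; exists N, (`|C| * A) => k.
apply: le_trans (mw k) _; rewrite -mulrA.
apply: le_trans (ler_wpM2l (normr_ge0 C) (HA k)).
by apply: le_trans (ler_norm _) _; rewrite normrM.
Qed.

Lemma norm_shifted_form_le (C : R) m a (i j : nat) :
  (forall k, `|m k| <= C * w k) -> rapid a -> (i <= 4)%N -> (j <= 4)%N ->
  `|tsum (fun k => m k * (a (k + i)%N * a (k + j)%N))| <= C * K * weighted_sqnorm w a.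
Proof.
move=> mw ra i4 j4; have tm := temperate_dominated mw.
have ri : rapid (fun k => a (k + i)%N) by apply: (rapid_reindex ra) => k; lia.
have rj : rapid (fun k => a (k + j)%N) by apply: (rapid_reindex ra) => k; lia.
have mw' k : `|- m k| <= C * w k by rewrite normrN.
rewrite ler_norml lerNl; apply/andP; split; last exact: (shifted_form_le sw).
apply: le_trans (shifted_form_le sw mw' ra i4 j4).
rewrite -mulN1r -tsumZ; last by apply: rapid_summable; rapidly.
by rewrite le_eqVlt; apply/orP; left; apply/eqP/eq_tsum => k; ring.
Qed.

(** With [T k = w k s k a k a (k-1)], the summand is
    [(w k - w (k+1)) s (k+1) a k a (k+1)] plus the difference of [T]. *)
Lemma first_order_bound : exists C, forall a, rapid a ->
  `|tsum (fun k => w k * a k * dstep a k)| <= C * weighted_sqnorm w a.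
Proof.
have tw := slow_temperate sw.
exists (K * K) => a ra; have rD := rapid_dstep ra.
pose m k := (w k - w k.+1) * ladder k.+1.
pose T k := w k * ladder k * (a k * a k.-1).
have rT : rapid T by rewrite /T; rapidly.
have tm : temperate m by rewrite /m; temper.
have rm : rapid (fun k => m k * (a (k + 0)%N * a (k + 1)%N)) by rapidly.
have -> : tsum (fun k => w k * a k * dstep a k)
    = tsum (fun k => m k * (a (k + 0)%N * a (k + 1)%N)).
  rewrite -[RHS]addr0 -(@tsum_telescope _ T); last 2 first.
  - by rewrite /T ladder0; ring.
  - exact: rapid_cvg0.
  rewrite -tsumD; [|exact: rapid_summable|apply: rapid_summable; rapidly].
  apply: eq_tsum => k; rewrite /T /m /dstep /= addn0 addn1; ring.
apply: norm_shifted_form_le => // k.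
have s1 : ladder k.+1 <= 2 * k%:R + 1 :> R.
  have x0 : 0 <= k%:R :> R by [].
  rewrite -ler_sqr ?nnegrE ?ladder_ge0 ?addr_ge0 ?mulr_ge0//.
  rewrite sqr_ladder -natr1; have := sqr_ge0 (k%:R : R); rewrite !expr2; lra.
rewrite /m normrM distrC (ger0_norm (ladder_ge0 _)).
apply: le_trans (ler_wpM2l (normr_ge0 _) s1) _.
by have := slow_diff1 sw k (isT : 1 <= 4)%N; rewrite addn1.
Qed.

(** The sum is [<(w D - D w) a, D a>], and the commutator
    [(w D - D w) a] at [k] is [- (e k a (k+1) + e' k a (k-1))] with
    [e k = s (k+1) (w (k+1) - w k)]. Moving all products [a i a j] with a lower
    index below [k] by a telescoping [T] leaves coefficients that contain one
    difference of [w] and two ladder factors. *)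
Lemma second_order_bound : exists C, forall a, rapid a ->
  tsum (fun k => w k * a k * dstep (dstep a) k)
  + tsum (fun k => w k * (dstep a k * dstep a k)) <= C * weighted_sqnorm w a.
Proof.
have tw := slow_temperate sw.
exists (4 * K * K + 4 * K * K + 8 * K * K) => a ra.
have rD := rapid_dstep ra; have rDD := rapid_dstep rD.
have rwa : rapid (fun k => w k * a k) by rapidly.
have rDwa := rapid_dstep rwa.
have -> : tsum (fun k => w k * a k * dstep (dstep a) k)
    = - tsum (fun k => dstep (fun k => w k * a k) k * dstep a k).
  by rewrite dstep_anti// opprK.
pose e k := ladder k.+1 * (w k.+1 - w k).
pose e' k := ladder k * (w k - w k.-1).
pose m1 k := - (e k * ladder k.+1).
pose m2 k := e k * ladder k.+1.
pose m3 k := e k.+1 * ladder k.+1 - e k * ladder k.+2.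
pose T k := e' k * a k.-1 * dstep a k - e k * ladder k * (a k.+1 * a k.-1).
have te : temperate e by rewrite /e; temper.
have te' : temperate e' by rewrite /e'; temper.
have tm1 : temperate m1 by rewrite /m1; temper.
have tm2 : temperate m2 by rewrite /m2; temper.
have tm3 : temperate m3 by rewrite /m3; temper.
have rT : rapid T by rewrite /T; rapidly.
have r1 : rapid (fun k => m1 k * (a (k + 1)%N * a (k + 1)%N)) by rapidly.
have r2 : rapid (fun k => m2 k * (a (k + 0)%N * a (k + 0)%N)) by rapidly.
have r3 : rapid (fun k => m3 k * (a (k + 0)%N * a (k + 2)%N)) by rapidly.
have -> : - tsum (fun k => dstep (fun k => w k * a k) k * dstep a k)
    + tsum (fun k => w k * (dstep a k * dstep a k))
  = tsum (fun k => m1 k * (a (k + 1)%N * a (k + 1)%N))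
  + tsum (fun k => m2 k * (a (k + 0)%N * a (k + 0)%N))
  + tsum (fun k => m3 k * (a (k + 0)%N * a (k + 2)%N)).
  rewrite -[RHS]addr0 -(@tsum_telescope _ T); last 2 first.
  - by rewrite /T /e' ladder0; ring.
  - exact: rapid_cvg0.
  rewrite -mulN1r -tsumZ; last by apply: rapid_summable; rapidly.
  rewrite -!tsumD; try (apply: rapid_summable; rapidly).
  apply: eq_tsum => k.
  rewrite /T /m1 /m2 /m3 /dstep /e /e' /= addn0 addn1 addn2; ring.
have b2 k : `|m2 k| <= 4 * K * w k.
  rewrite (_ : m2 k = ladder (k + 1) * ladder (k + 1)
    * (w (k + 1)%N - w (k + 0)%N)); first exact: ladder_diff1_le.
  by rewrite /m2 /e addn0 addn1; ring.
have b1 k : `|m1 k| <= 4 * K * w k by rewrite normrN; exact: b2.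
have b3 k : `|m3 k| <= 8 * K * w k.
  rewrite (_ : m3 k = ladder (k + 1) * ladder (k + 2)
    * (w (k + 2)%N - w (k + 1)%N) - ladder (k + 1) * ladder (k + 2)
    * (w (k + 1)%N - w (k + 0)%N)); last first.
    by rewrite /m3 /e addn0 addn1 addn2; ring.
  apply: le_trans (ler_normB _ _) _.
  apply: le_trans (lerD (@ladder_diff1_le k 1 2 2 1 _ _ _ _)
    (@ladder_diff1_le k 1 2 1 0 _ _ _ _)) _ => //; lra.
rewrite 2!mulrDl; apply: lerD; first apply: lerD; exact: (shifted_form_le sw).
Qed.

(** The sum is [<(w D^2 - D^2 w) a, D^2 a>]. The commutator at [k] is
    [- (dl k a (k+2) - dl' k a (k-2))], where [dl k] contains one difference of
    [w] and is only [O(w)], while the entries [al] and [-(s (k+1)^2 + s k^2)] of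
    [D^2] are [O(k)]. The products are brought to the form [a k a (k+j)] by the
    telescoping term [V k - V (k+2)], written below as the difference of [T].
    In the coefficient of [a k a (k+4)] the two contributions then combine to a
    second difference of [w], in that of [a k ^ 2] to a second difference of [w]
    and a first difference multiplied by a difference of [al ^ 2], and in that of
    [a k a (k+2)] to [dl k] multiplied by a difference of two diagonal entries of
    [D^2], which is constant. *)
Lemma fourth_order_bound : exists C, forall a, rapid a ->
  tsum (fun k => w k * (dstep (dstep a) k * dstep (dstep a) k))
  - tsum (fun k => w k * a k * dstep (dstep (dstep (dstep a))) k)
   <= C * weighted_sqnorm w a.
Proof.
have tw := slow_temperate sw.
exists (100 * K * K * K + 8 * K * K + 4 * K * K) => a ra.
have rD := rapid_dstep ra; have rDD := rapid_dstep rD.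
have rDDD := rapid_dstep rDD; have rDDDD := rapid_dstep rDDD.
have rwa : rapid (fun k => w k * a k) by rapidly.
have rDwa := rapid_dstep rwa; have rDDwa := rapid_dstep rDwa.
have -> : tsum (fun k => w k * a k * dstep (dstep (dstep (dstep a))) k)
    = tsum (fun k => dstep (dstep (fun k => w k * a k)) k * dstep (dstep a) k).
  by rewrite (dstep_anti rDwa rDD) (dstep_anti rwa rDDD) opprK.
pose al k := ladder k.+1 * ladder k.+2 : R.
pose al' k := ladder k * ladder k.-1 : R.
pose dl k := al k * (w k.+2 - w k).
pose dl' k := al' k * (w k - w k.-2).
pose m1 k := dl k * al k - dl' k * al' k.
pose m2 k := - ((ladder k.+3 * ladder k.+3 + ladder k.+2 * ladder k.+2
   - ladder k.+1 * ladder k.+1 - ladder k * ladder k) * dl k).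
pose m3 k := dl k * al k.+2 - dl k.+2 * al k.
pose V k := dl' k * a k.-2 * dstep (dstep a) k + dl' k * al' k * (a k * a k)
   - dl k * al' k * (a k.+2 * a k.-2).
pose T k := - (V k + V k.+1).
have tal : temperate al by rewrite /al; temper.
have tal' : temperate al' by rewrite /al'; temper.
have tdl : temperate dl by rewrite /dl; temper.
have tdl' : temperate dl' by rewrite /dl'; temper.
have tm1 : temperate m1 by rewrite /m1; temper.
have tm2 : temperate m2 by rewrite /m2; temper.
have tm3 : temperate m3 by rewrite /m3; temper.
have rV : rapid V by rewrite /V; rapidly.
have rT : rapid T by rewrite /T; rapidly.
have r1 : rapid (fun k => m1 k * (a (k + 0)%N * a (k + 0)%N)) by rapidly.
have r2 : rapid (fun k => m2 k * (a (k + 0)%N * a (k + 2)%N)) by rapidly.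
have r3 : rapid (fun k => m3 k * (a (k + 0)%N * a (k + 4)%N)) by rapidly.
have -> : tsum (fun k => w k * (dstep (dstep a) k * dstep (dstep a) k)) -
    tsum (fun k => dstep (dstep (fun k => w k * a k)) k * dstep (dstep a) k)
  = tsum (fun k => m1 k * (a (k + 0)%N * a (k + 0)%N))
  + tsum (fun k => m2 k * (a (k + 0)%N * a (k + 2)%N))
  + tsum (fun k => m3 k * (a (k + 0)%N * a (k + 4)%N)).
  rewrite -[RHS]addr0 -(@tsum_telescope _ T); last 2 first.
  - by rewrite /T /V /dl' /al' /= ladder0; ring.
  - exact: rapid_cvg0.
  rewrite -mulN1r -tsumZ; last by apply: rapid_summable; rapidly.
  rewrite -!tsumD; try (apply: rapid_summable; rapidly).
  apply: eq_tsum => -[|k];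
    rewrite /T /V /m1 /m2 /m3 /dstep /dl /dl' /al /al' /= ?addn0 ?addn2 ?addn4
      ?ladder0; ring.
have b2 k : `|m2 k| <= 8 * K * w k.
  rewrite /m2 -!expr2 !sqr_ladder normrN.
  rewrite -[k.+3%:R]natr1 -[k.+2%:R]natr1 -[k.+1%:R]natr1.
  rewrite (_ : _ * dl k = 2 * (ladder (k + 1) * ladder (k + 2)
    * (w (k + 2)%N - w (k + 0)%N))); last first.
    by rewrite /dl /al addn0 addn1 addn2; field.
  rewrite normrM ger0_norm//.
  have := @ladder_diff1_le k 1 2 2 0 isT isT isT isT; lra.
have x2 k : 0 <= 2 * k%:R + 1 :> R by rewrite addr_ge0// mulr_ge0.
have b3 k : `|m3 k| <= 4 * K * w k.
  rewrite (_ : m3 k = - (ladder (k + 1) * ladder (k + 2))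
    * (ladder (k + 3) * ladder (k + 4))
    * (w k.+4 - 2 * w k.+2 + w k)); last first.
    by rewrite /m3 /dl /al addn1 addn2 addn3 addn4; ring.
  rewrite !mulNr normrN normrM ger0_norm ?mulr_ge0 ?ladder_ge0//.
  have H := slow_diff2 sw k.
  have L := ler_pM _ _ (@ladder_ladder_le k 1 2 isT isT)
    (@ladder_ladder_le k 3 4 isT isT).
  apply: le_trans (ler_wpM2r (normr_ge0 _) (L _ _)) _;
    rewrite ?mulr_ge0 ?ladder_ge0//.
  move: H; rewrite expr2; lra.
have K1 := slow_const_ge1; have K0 : 0 <= K by apply: le_trans K1.
have KK k : K * w k <= K * K * w k by rewrite ler_wpM2r ?slow_ge0// ler_peMr.
(* At k = 0 and k = 1 there is no second difference, but k is bounded. *)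
have b1small k : al' k = 0 -> 2 * k%:R + 1 <= 3 :> R ->
    `|m1 k| <= 100 * K * K * w k.
  move=> al'0 k3; rewrite /m1 /dl' al'0 mul0r mulr0 subr0.
  rewrite (_ : dl k * al k = ladder (k + 1) * ladder (k + 2)
    * (ladder (k + 1) * ladder (k + 2) * (w (k + 2)%N - w (k + 0)%N)));
    last by rewrite /dl /al addn0 addn1 addn2; ring.
  rewrite normrM ger0_norm ?mulr_ge0 ?ladder_ge0//.
  apply: le_trans (ler_pM _ _ (@ladder_ladder_le k 1 2 isT isT)
    (@ladder_diff1_le k 1 2 2 0 isT isT isT isT)) _ => //.
    by rewrite ?mulr_ge0 ?ladder_ge0.
  have Kw : 0 <= K * w k by rewrite mulr_ge0 ?slow_ge0.
  have := ler_wpM2r Kw k3; have := KK k; lra.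
have b1 k : `|m1 k| <= 100 * K * K * w k.
  case: k => [|[|k]].
  - by apply: b1small; [rewrite /al' ladder0 mul0r|lra].
  - by apply: b1small; [rewrite /al' ladder0 mulr0|lra].
  rewrite (_ : m1 k.+2 = (ladder (k + 1) * ladder (k + 2))
      * (ladder (k + 1) * ladder (k + 2)) * (w k.+4 - 2 * w k.+2 + w k)
    + (ladder k.+3 ^+ 2 * ladder k.+4 ^+ 2 - ladder k.+1 ^+ 2 * ladder k.+2 ^+ 2)
      * ((w (k + 4)%N - w k) - (w (k + 2)%N - w k))); last first.
    by rewrite /m1 /dl' /dl /al' /al /= addn1 addn2 addn4; ring.
  rewrite !sqr_ladder -[k.+4%:R]natr1 -[k.+3%:R]natr1 -[k.+2%:R]natr1 -[k.+1%:R]natr1.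
  set c := (X in X * (_ - _)).
  have c0 : 0 <= c.
    rewrite (_ : c = k%:R + 5 / 2); last by rewrite /c; field.
    by rewrite addr_ge0.
  have cx : c <= 3 * (2 * k%:R + 1).
    rewrite (_ : c = k%:R + 5 / 2); last by rewrite /c; field.
    by have := ler0n R k; lra.
  have H := slow_diff2 sw k.
  have H4 := slow_diff1 sw k (isT : 4 <= 4)%N.
  have H2 := slow_diff1 sw k (isT : 2 <= 4)%N.
  have L0 : 0 <= ladder (k + 1) * ladder (k + 2) :> R.
    by rewrite mulr_ge0 ?ladder_ge0.
  have L := ler_pM L0 L0 (@ladder_ladder_le k 1 2 isT isT)
    (@ladder_ladder_le k 1 2 isT isT).
  have P1 : `|(ladder (k + 1) * ladder (k + 2))
      * (ladder (k + 1) * ladder (k + 2)) * (w k.+4 - 2 * w k.+2 + w k)|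
      <= 4 * K * w k.
    rewrite normrM ger0_norm ?mulr_ge0 ?ladder_ge0//.
    apply: le_trans (ler_wpM2r (normr_ge0 _) L) _.
    move: H; rewrite expr2; lra.
  have P2 : `|c * (w (k + 4)%N - w k - (w (k + 2)%N - w k))| <= 6 * K * w k.
    rewrite normrM ger0_norm//.
    apply: le_trans (ler_wpM2r (normr_ge0 _) cx) _.
    have := ler_wpM2l (x2 k) (ler_normB (w (k + 4)%N - w k) (w (k + 2)%N - w k)).
    lra.
  apply: le_trans (ler_normD _ _) _; apply: le_trans (lerD P1 P2) _.
  have := ler_wpM2l K0 (slow_ratio sw k (isT : 2 <= 4)%N); rewrite addn2.
  have : 0 <= K * K * w k.+2 by rewrite !mulr_ge0 ?slow_ge0.
  lra.
rewrite 2!mulrDl; apply: lerD; first apply: lerD; exact: (shifted_form_le sw).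
Qed.

(** The orders four, two and one separate: [2 L + A_1^* A_1 + A_2^* A_2] is
    [kappa^2] times the fourth order form, plus [sigma^2] times the second order
    form, minus [2 c] times the first order form. *)
Lemma generator_bound (kappa sigma c : R) : exists C, 0 < C /\ forall a, rapid a ->
  2 * tsum (fun k => w k * a k *
    (- (kappa ^+ 2 / 2) * dstep (dstep (dstep (dstep a))) k
     + sigma ^+ 2 / 2 * dstep (dstep a) k - c * dstep a k))
  + (tsum (fun k => w k * (- sigma * dstep a k) * (- sigma * dstep a k))
    + tsum (fun k => w k * (kappa * dstep (dstep a) k)
                         * (kappa * dstep (dstep a) k)))
  <= C * weighted_sqnorm w a.
Proof.
have tw := slow_temperate sw.
have [C1 H1] := first_order_bound; have [C2 H2] := second_order_bound.
have [C4 H4] := fourth_order_bound.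
pose C := `|2 * c| * C1 + sigma ^+ 2 * C2 + kappa ^+ 2 * C4.
exists (`|C| + 1); split; first by rewrite ltr_wpDl.
move=> a ra.
have rD := rapid_dstep ra; have rDD := rapid_dstep rD.
have rDDD := rapid_dstep rDD; have rDDDD := rapid_dstep rDDD.
have rq : rapid (fun k => w k * (a k * a k)) by rapidly.
have q0 : 0 <= weighted_sqnorm w a.
  apply: tsum_ge0; last exact: rapid_summable.
  by move=> k; rewrite mulr_ge0 ?slow_ge0// -expr2 sqr_ge0.
apply: (@le_trans _ _ (C * weighted_sqnorm w a)); last first.
  by rewrite ler_wpM2r// (le_trans (ler_norm C))// lerDl.
have {}H1 := H1 a ra; have {}H2 := H2 a ra; have {}H4 := H4 a ra.
have {}H1 : - (2 * c) * tsum (fun k => w k * a k * dstep a k)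
    <= `|2 * c| * (C1 * weighted_sqnorm w a).
  apply: le_trans (ler_norm _) _; rewrite normrM normrN.
  by rewrite ler_wpM2l.
have {}H2 := ler_wpM2l (sqr_ge0 sigma) H2.
have {}H4 := ler_wpM2l (sqr_ge0 kappa) H4.
have -> : C * weighted_sqnorm w a = `|2 * c| * (C1 * weighted_sqnorm w a)
    + sigma ^+ 2 * (C2 * weighted_sqnorm w a) + kappa ^+ 2 * (C4 * weighted_sqnorm w a).
  by rewrite /C; ring.
apply: le_trans (lerD (lerD H1 H2) H4).
rewrite le_eqVlt; apply/orP; left; apply/eqP.
have S1 : rapid (fun k => w k * a k * dstep a k) by rapidly.
have S2 : rapid (fun k => w k * a k * dstep (dstep a) k) by rapidly.
have S3 : rapid (fun k => w k * (dstep a k * dstep a k)) by rapidly.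
have S4 : rapid (fun k => w k * (dstep (dstep a) k * dstep (dstep a) k)).
  by rapidly.
have S5 : rapid (fun k => w k * a k * dstep (dstep (dstep (dstep a))) k).
  by rapidly.
rewrite (@eq_tsum _ _ (fun k =>
    - (kappa ^+ 2 / 2) * (w k * a k * dstep (dstep (dstep (dstep a))) k)
    + sigma ^+ 2 / 2 * (w k * a k * dstep (dstep a) k)
    + - c * (w k * a k * dstep a k))); last by move=> k; ring.
rewrite 2?tsumD; try (apply: rapid_summable; rapidly).
rewrite (@eq_tsum _ (fun k => w k * (- sigma * dstep a k) * _) (fun k =>
    sigma ^+ 2 * (w k * (dstep a k * dstep a k)))); last by move=> k; ring.
rewrite (@eq_tsum _ (fun k => w k * (kappa * dstep (dstep a) k) * _) (fun k =>
    kappa ^+ 2 * (w k * (dstep (dstep a) k * dstep (dstep a) k))));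
  last by move=> k; ring.
rewrite !tsumZ; try (apply: rapid_summable; rapidly).
by field.
Qed.

(** The derivative loses half an order: [s k^2 = O(2 k + 1)]. *)
Lemma dstep_norm_bound : exists C, 0 <= C /\ forall a, rapid a ->
  weighted_sqnorm w (dstep a) <= C * weighted_sqnorm (fun k => w k * (2 * k%:R + 1)) a.
Proof.
have tw := slow_temperate sw.
have K1 := slow_const_ge1; have K0 : 0 <= K by apply: le_trans K1.
exists (2 * K + 2 * (1 + K)); split; first by rewrite !addr_ge0 ?mulr_ge0 ?addr_ge0.
move=> a ra; have rD := rapid_dstep ra.
have tx : temperate (fun k => 2 * k%:R + 1 : R).
  apply: (@temperate_le _ _ 1 2) => k; have k0 := ler0n R k.
  by rewrite expr1 -natr1 ger0_norm; lra.
pose y k : R := 2 * k%:R + 1.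
have y1 k : 1 <= y k by rewrite /y lerDr mulr_ge0.
pose b k := w k * y k * (a k * a k).
have rb : rapid b by rewrite /b /y; rapidly.
have b0 k : 0 <= b k.
  apply: mulr_ge0; last by rewrite -expr2 sqr_ge0.
  by apply: mulr_ge0; [exact: slow_ge0|exact: le_trans ler01 (y1 k)].
have rbS := rapidS rb.
have w1 k : w k.+1 <= (1 + K) * w k.
  have := slow_diff1 sw k (isT : 1 <= 4)%N; rewrite addn1.
  have := ler_norm (w k.+1 - w k).
  have := ler_wpM2l (normr_ge0 (w k.+1 - w k)) (y1 k).
  rewrite /y; lra.
pose u1 k := w k * (ladder k.+1 * ladder k.+1 * (a k.+1 * a k.+1)).
pose u2 k := w k * (ladder k * ladder k * (a k.-1 * a k.-1)).
have r1 : rapid u1 by rewrite /u1; rapidly.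
have r2 : rapid u2 by rewrite /u2; rapidly.
have sy k : ladder k.+1 * ladder k.+1 <= y k.
  by rewrite -expr2 sqr_ladder -natr1 /y; have := ler0n R k; lra.
have H1 : tsum u1 <= K * tsum b.
  apply: (@le_trans _ _ (tsum (fun k => K * b k.+1))).
    apply: le_tsum; try (apply: rapid_summable; rapidly).
    move=> k; rewrite /u1 /b mulrA [leRHS]mulrA.
    apply: ler_wpM2r; first by rewrite -expr2 sqr_ge0.
    rewrite [leRHS]mulrA.
    have := slow_ratio sw k (isT : 1 <= 4)%N; rewrite addn1 => Hw.
    apply: ler_pM => //; rewrite ?slow_ge0 ?mulr_ge0 ?ladder_ge0//.
    apply: le_trans (sy k) _.
    by rewrite /y -[k.+1%:R]natr1; lra.
  rewrite tsumZ ?ler_wpM2l//; last exact: rapid_summable.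
  by rewrite [leRHS]tsumS ?lerDr//; exact: rapid_summable.
have H2 : tsum u2 <= (1 + K) * tsum b.
  rewrite tsumS; last exact: rapid_summable.
  rewrite {1}/u2 ladder0 !mul0r mulr0 add0r -tsumZ; last exact: rapid_summable.
  apply: le_tsum; [exact/rapid_summable/rapidS| |].
    apply: rapid_summable; apply: (@rapidM _ (fun=> 1 + K)) => //.
    exact: temperate_cst.
  move=> k; rewrite /u2 /b /= mulrA [leRHS]mulrA.
  apply: ler_wpM2r; first by rewrite -expr2 sqr_ge0.
  rewrite [leRHS]mulrA.
  by apply: ler_pM => //; rewrite ?slow_ge0 ?mulr_ge0 ?ladder_ge0.
apply: (@le_trans _ _ (2 * tsum u1 + 2 * tsum u2)); last first.
  by have := lerD H1 H2; rewrite /weighted_sqnorm -/(b _); lra.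
rewrite -!tsumZ; [|exact: rapid_summable..].
have t2 := @temperate_cst R 2.
have r1' := rapidM t2 r1; have r2' := rapidM t2 r2.
rewrite -tsumD; [|exact: rapid_summable..].
apply: le_tsum; try (apply: rapid_summable; rapidly).
move=> k; rewrite /u1 /u2 /dstep.
rewrite -subr_ge0 (_ : _ - _ = w k * (ladder k.+1 * a k.+1 + ladder k * a k.-1) ^+ 2).
  by rewrite mulr_ge0 ?sqr_ge0 ?slow_ge0.
by ring.
Qed.
End estimate.
End weighted.

(** * The weights of the Hermite-Sobolev norms *)

Section hermite_weight.
Context {R : realType}.
Implicit Types (r x y : R).

Lemma powR_ratio r x y : 0 < x -> x <= y -> y <= 9 * x ->
  y `^ r <= 9 `^ `|r| * x `^ r /\ x `^ r <= 9 `^ `|r| * y `^ r.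
Proof.
move=> x0 xy yx; have y0 : 0 < y by apply: lt_le_trans xy.
have xn : x != 0 by rewrite lt0r_neq0.
have t1 : 1 <= y / x by rewrite ler_pdivlMr// mul1r.
have t9 : y / x <= 9 by rewrite ler_pdivrMr.
have H (q : R) : (y / x) `^ q <= 9 `^ `|q|.
  apply: (@le_trans _ _ ((y / x) `^ `|q|)); first by rewrite ler_powR// ler_norm.
  by rewrite ge0_ler_powR// nnegrE// (le_trans ler01).
have E : y `^ r = (y / x) `^ r * x `^ r.
  by rewrite -powRM ?divfK// ?(ltW x0)// (le_trans ler01).
split; first by rewrite E ler_wpM2r ?powR_ge0.
have -> : x `^ r = (y / x) `^ (- r) * y `^ r.
  rewrite E mulrA -powRD ?addNr ?powRr0 ?mul1r//.
  by apply/implyP => _; rewrite lt0r_neq0// divr_gt0.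
by rewrite ler_wpM2r ?powR_ge0// -(normrN r).
Qed.

Lemma powRB1 r x : 0 < x -> x `^ (r - 1) * x = x `^ r.
Proof.
move=> x0; rewrite powRB ?lt0r_neq0 ?implybT// powRr1 ?ltW//.
by rewrite divfK// lt0r_neq0.
Qed.

Lemma powR_diff1 r x (h : R) : 0 < x -> 0 <= h -> h <= 8 * x ->
  `|(x + h) `^ r - x `^ r| <= h * `|r| * 9 `^ `|r - 1| * x `^ (r - 1).
Proof.
move=> x0 h0 hx.
have xh : x <= x + h by rewrite lerDl.
have pos y : x <= y -> 0 < y by apply: lt_le_trans.
have D y : 0 < y -> is_derive y (1 : R) (fun z : R => z `^ r) (r * y `^ (r - 1)).
  by move=> y0; exact: is_derive1_powR.
have [||y] := @MVT_segment R (fun z : R => z `^ r) (fun z => r * z `^ (r - 1)) _ _ xh.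
- by move=> y; rewrite in_itv/= => /andP[/ltW/pos y0 _]; exact: D.
- apply: derivable_within_continuous => y; rewrite in_itv/= => /andP[/pos y0 _].
  exact: (@ex_derive _ _ _ _ _ _ _ (D y y0)).
rewrite in_itv/= => /andP[xy yxh] ->.
rewrite [x + h]addrC addrK !normrM (ger0_norm h0) (ger0_norm (powR_ge0 _ _)).
rewrite mulrC -!mulrA ler_wpM2l// ler_wpM2l//.
by apply: (powR_ratio (r - 1) x0 xy _).1; lra.
Qed.

(** The mean value theorem for [z |-> (z + h)^r - z^r], then [powR_diff1] with
    exponent [r - 1]. *)
Lemma powR_diff2 r x (h : R) : 0 < x -> 0 <= h -> h <= 4 * x ->
  `|(x + h + h) `^ r - 2 * (x + h) `^ r + x `^ r|
  <= h ^+ 2 * `|r| * `|r - 1| * (9 `^ `|r - 1 - 1|) ^+ 2 * x `^ (r - 1 - 1).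
Proof.
move=> x0 h0 hx.
have xh : x <= x + h by rewrite lerDl.
have pos y : x <= y -> 0 < y by apply: lt_le_trans.
pose g (z : R) := (z + h) `^ r - z `^ r.
pose g' (z : R) := r * ((z + h) `^ (r - 1) - z `^ (r - 1)).
have D y : 0 < y -> is_derive y (1 : R) g (g' y).
  move=> y0; have yh0 : 0 < y + h by apply: ltr_wpDr.
  have D1 : is_derive y (1 : R) (fun z : R => z + h) 1.
    by apply: is_derive_eq; rewrite addr0.
  have D2 := @is_derive1_comp R (fun z => z `^ r) (fun z : R => z + h) _ _ _
    (is_derive1_powR r yh0) D1.
  have := is_deriveB D2 (is_derive1_powR r y0).
  by move=> /is_derive_eq; apply; rewrite /g'; ring.
have [||y] := @MVT_segment R g g' _ _ xh.
- by move=> y; rewrite in_itv/= => /andP[/ltW/pos y0 _]; exact: D.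
- apply: derivable_within_continuous => y; rewrite in_itv/= => /andP[/pos y0 _].
  exact: (@ex_derive _ _ _ _ _ _ _ (D y y0)).
rewrite in_itv/= => /andP[xy yxh].
rewrite (_ : g (x + h) - g x
  = (x + h + h) `^ r - 2 * (x + h) `^ r + x `^ r); last by rewrite /g; ring.
move=> ->; rewrite [x + h]addrC addrK normrM (ger0_norm h0) /g' normrM.
have y0 := pos _ xy.
have hy : h <= 8 * y by lra.
have H1 := powR_diff1 (r - 1) y0 h0 hy.
have H2 : y `^ (r - 1 - 1) <= 9 `^ `|r - 1 - 1| * x `^ (r - 1 - 1).
  by apply: (powR_ratio _ x0 xy _).1; lra.
have H3 : h * `|r - 1| * 9 `^ `|r - 1 - 1| * y `^ (r - 1 - 1) <=
   h * `|r - 1| * 9 `^ `|r - 1 - 1| * (9 `^ `|r - 1 - 1| * x `^ (r - 1 - 1)).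
  by rewrite ler_wpM2l// !mulr_ge0// powR_ge0.
have := ler_wpM2r h0 (ler_wpM2l (normr_ge0 r) (le_trans H1 H3)).
move=> /le_trans; apply; rewrite le_eqVlt; apply/orP; left; apply/eqP; ring.
Qed.

Definition hermite_weight (p : R) (k : nat) : R := (2 * k%:R + 1) `^ (2 * p).

Lemma hermite_weight_slow p : exists K, slow_weight (hermite_weight p) K.
Proof.
pose r := 2 * p.
pose K1 := 9 `^ `|r|; pose K2 := 8 * `|r| * 9 `^ `|r - 1|.
pose K3 := 4 ^+ 2 * `|r| * `|r - 1| * (9 `^ `|r - 1 - 1|) ^+ 2.
have K10 : 0 <= K1 by exact: powR_ge0.
have K20 : 0 <= K2 by rewrite !mulr_ge0// powR_ge0.
have K30 : 0 <= K3 by rewrite !mulr_ge0// exprn_ge0// powR_ge0.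
exists (K1 + K2 + K3).
have x0 k : 0 < 2 * k%:R + 1 :> R by rewrite ltr_wpDl// mulr_ge0.
have x1 k : 1 <= 2 * k%:R + 1 :> R by rewrite lerDr mulr_ge0.
have w0 k : 0 < hermite_weight p k by rewrite powR_gt0.
have wE k j : hermite_weight p (k + j)%N = (2 * k%:R + 1 + 2 * j%:R) `^ r.
  by rewrite /hermite_weight natrD -/r; congr (_ `^ _); ring.
have j8 j : (j <= 4)%N -> 2 * j%:R <= 8 :> R.
  by rewrite -(ler_nat R) => H; lra.
split => //.
- pose n := Num.bound `|r|.
  apply: (@temperate_le _ _ n (2 ^+ n)) => k.
  rewrite ger0_norm ?(ltW (w0 k))//.
  apply: (@le_trans _ _ ((2 * k%:R + 1) `^ n%:R)).
    rewrite ler_powR//; apply: le_trans (ler_norm _) _.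
    exact/ltW/archi_boundP.
  rewrite powR_mulrn ?(ltW (x0 k))// -exprMn lerXn2r// ?nnegrE ?(ltW (x0 k))//.
  by rewrite -[k.+1%:R]natr1; lra.
- move=> k j j4; rewrite wE /hermite_weight -/r.
  have Hj := j8 _ j4.
  apply: (@le_trans _ _ (K1 * (2 * k%:R + 1 + 2 * j%:R) `^ r)).
    apply: (powR_ratio r (x0 k) _ _).2; first by rewrite lerDl mulr_ge0.
    by have := x1 k; lra.
  by rewrite ler_wpM2r ?powR_ge0//; lra.
- move=> k j j4; rewrite wE /hermite_weight -/r.
  have Hj := j8 _ j4.
  have h0 : 0 <= 2 * j%:R :> R by rewrite mulr_ge0.
  have hx : 2 * j%:R <= 8 * (2 * k%:R + 1) :> R by have := x1 k; lra.
  have H := ler_wpM2r (ltW (x0 k)) (powR_diff1 r (x0 k) h0 hx).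
  apply: le_trans H _; rewrite [leLHS](_ : _ = 2 * j%:R * `|r| * 9 `^ `|r - 1|
    * ((2 * k%:R + 1) `^ (r - 1) * (2 * k%:R + 1))); last by ring.
  rewrite (powRB1 r (x0 k)).
  rewrite ler_wpM2r ?powR_ge0//.
  apply: (@le_trans _ _ K2); last by lra.
  by rewrite /K2 (ler_wpM2r (powR_ge0 _ _))// ler_wpM2r.
- move=> k.
  have -> : hermite_weight p k.+4 = (2 * k%:R + 1 + 4 + 4) `^ r.
    by rewrite -addn4 wE; congr (_ `^ _); ring.
  have -> : hermite_weight p k.+2 = (2 * k%:R + 1 + 4) `^ r.
    by rewrite -addn2 wE; congr (_ `^ _); ring.
  rewrite /hermite_weight -/r.
  have hx : 4 <= 4 * (2 * k%:R + 1) :> R by have := x1 k; lra.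
  have := powR_diff2 r (x0 k) (ler0n _ 4) hx.
  move=> /(ler_wpM2r (exprn_ge0 2 (ltW (x0 k)))).
  move=> /le_trans; apply; rewrite -/K3 -mulrA expr2 [_ `^ _ * _]mulrA.
  rewrite (powRB1 (r - 1) (x0 k)) (powRB1 r (x0 k)).
  by rewrite ler_wpM2r ?powR_ge0//; lra.
Qed.

End hermite_weight.

(** * Limits of real sequences *)

Section real_sequences.
Context {R : realType}.
Implicit Types (x y : nat -> R) (l c : R).

Lemma cvg_close x y l : x n - y n @[n --> \oo] --> 0 ->
  y n @[n --> \oo] --> l -> x n @[n --> \oo] --> l.
Proof.
move=> xy yl; rewrite -[l]add0r (_ : x = fun n => (x n - y n) + y n).
  exact: cvgD.
by apply/funext => n; rewrite subrK.
Qed.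

Lemma cvg_opp_shift x c : x n @[n --> \oo] --> 0 ->
  -1 * x n + c @[n --> \oo] --> c.
Proof.
move=> x0; rewrite -[X in _ --> X](add0r c) -[X in _ --> X + _](mulr0 (-1)).
by apply: cvgD; [exact: cvgMl_tmp|exact: cvg_cst].
Qed.

Lemma le_lim_comb (c : R) x y z t (lx ly lz lt0 : R) :
  (forall n, 2 * x n + (y n + z n) <= c * t n) ->
  x n @[n --> \oo] --> lx -> y n @[n --> \oo] --> ly ->
  z n @[n --> \oo] --> lz -> t n @[n --> \oo] --> lt0 ->
  2 * lx + (ly + lz) <= c * lt0.
Proof.
move=> H cx cy cz ct.
have c1 : 2 * x n + (y n + z n) @[n --> \oo] --> 2 * lx + (ly + lz).
  by apply: cvgD; [exact: cvgMl_tmp|exact: cvgD].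
have c2 : c * t n @[n --> \oo] --> c * lt0 by exact: cvgMl_tmp.
by apply: (ler_cvg_to c1 c2); apply: nearW => n; exact: H.
Qed.
End real_sequences.

(** * Hermite-Sobolev norms and representing sequences *)

Section completion.
Context {R : realType}.
Implicit Types (p q : R) (f g h : schwartz R) (u v : tempered R).

Definition sqnorm p f : R := schwartz_inner p f f.

Lemma schwartz_innerE p f g : schwartz_inner p f g
  = tsum (fun k => hermite_weight p k * hermite_coef f k * hermite_coef g k).
Proof. by []. Qed.

Lemma sqnormE p f : sqnorm p f = weighted_sqnorm (hermite_weight p) (hermite_coef f).
Proof.
by rewrite /sqnorm schwartz_innerE; apply: eq_tsum => k; rewrite mulrA.
Qed.

Lemma hermite_weight_temperate p : temperate (hermite_weight p).
Proof. by have [K sw] := hermite_weight_slow p; exact: slow_temperate sw. Qed.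

Lemma hermite_weight_gt0 p k : 0 < hermite_weight p k.
Proof. by have [K sw] := hermite_weight_slow p; exact: slow_gt0 sw k. Qed.

Lemma inner_summable p f g : cvgn (series (fun k =>
  hermite_weight p k * hermite_coef f k * hermite_coef g k)).
Proof.
have tw := hermite_weight_temperate p.
have rf := hermite_coef_rapid f; have rg := hermite_coef_rapid g.
apply: rapid_summable; rapidly.
Qed.

Lemma schwartz_innerC p f g : schwartz_inner p f g = schwartz_inner p g f.
Proof. by rewrite !schwartz_innerE; apply: eq_tsum => k; rewrite mulrAC. Qed.

Lemma schwartz_inner_comb p a f g h : schwartz_inner p (a *: f + g) h
  = a * schwartz_inner p f h + schwartz_inner p g h.
Proof.
rewrite !schwartz_innerE -tsumZ; last exact: inner_summable.
rewrite -tsumD; [|apply: is_cvg_seriesZ; exact: inner_summable|exact: inner_summable].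
by apply: eq_tsum => k; rewrite hermite_coef_comb; ring.
Qed.

#[local] Opaque schwartz_inner l2_inner.

Lemma sqnorm_ge0 p f : 0 <= sqnorm p f.
Proof.
rewrite /sqnorm schwartz_innerE; apply: tsum_ge0; last exact: inner_summable.
by move=> k; rewrite -mulrA -expr2 mulr_ge0 ?sqr_ge0// ltW// hermite_weight_gt0.
Qed.

Lemma sqr_schwartz_norm p f : schwartz_norm p f ^+ 2 = sqnorm p f.
Proof. by rewrite sqr_sqrtr// sqnorm_ge0. Qed.

Lemma sqnorm_comb p a f g : sqnorm p (a *: f + g)
  = a ^+ 2 * sqnorm p f + 2 * a * schwartz_inner p f g + sqnorm p g.
Proof.
rewrite /sqnorm schwartz_inner_comb ![schwartz_inner p _ (_ + _)]schwartz_innerC.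
by rewrite !schwartz_inner_comb (schwartz_innerC p g f); ring.
Qed.

(** Half of the parallelogram identity. *)
Lemma sqnorm_comb_le p a f g :
  sqnorm p (a *: f + g) <= 2 * a ^+ 2 * sqnorm p f + 2 * sqnorm p g.
Proof.
have := sqnorm_ge0 p (- a *: f + g); rewrite !sqnorm_comb sqrrN; lra.
Qed.

(** The Cauchy-Schwarz inequality with a parameter [t] instead of square roots. *)
Lemma inner_le p f g (t : R) : 0 < t ->
  `|schwartz_inner p f g| <= t^-1 * sqnorm p f + t * sqnorm p g.
Proof.
move=> t0; have H a := sqnorm_ge0 p (a *: f + g).
have t1 : 0 <= t^-1 * sqnorm p f + t * sqnorm p g.
  by rewrite addr_ge0 ?mulr_ge0 ?sqnorm_ge0 ?invr_ge0 ?(ltW t0).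
have P (s : R) : s ^+ 2 = 1 ->
    0 <= t^-1 * sqnorm p f + 2 * s * schwartz_inner p f g + t * sqnorm p g.
  move=> s1; have := H (s * t^-1); rewrite sqnorm_comb => /(mulr_ge0 (ltW t0)).
  congr (_ <= _); rewrite exprMn s1; field; rewrite lt0r_neq0//.
have := P 1 (expr1n _ _); have := P (-1) (sqrr_sign R 1).
rewrite ler_norml => *; apply/andP; split; lra.
Qed.

(** The first condition in [represents], for squared norms. *)
Definition sobolev_cauchy p (f : nat -> schwartz R) : Prop :=
  forall e : R, 0 < e -> exists N : nat, forall m n : nat,
     (N <= m)%N -> (N <= n)%N -> sqnorm p (f m - f n) < e.

Lemma sobolev_cauchyP p (f : nat -> schwartz R) :
  (forall e : R, 0 < e -> exists N : nat, forall m n : nat,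
     (N <= m)%N -> (N <= n)%N -> schwartz_norm p (f m - f n) < e) <->
  sobolev_cauchy p f.
Proof.
split=> H e e0.
  have [|N HN] := H (Num.sqrt e); first by rewrite sqrtr_gt0.
  by exists N => m n Hm Hn; have := HN m n Hm Hn; rewrite ltr_sqrt.
have [N HN] := H _ (exprn_gt0 2 e0).
exists N => m n Hm Hn; rewrite -ltr_sqr ?nnegrE ?sqrtr_ge0 ?(ltW e0)//.
by rewrite sqr_schwartz_norm; exact: HN.
Qed.

Lemma subr_comb f g : f - g = -1 *: g + f.
Proof. by rewrite scaleN1r addrC. Qed.

Lemma sobolev_cauchy_comb p a (f g : nat -> schwartz R) :
  sobolev_cauchy p f -> sobolev_cauchy p g ->
  sobolev_cauchy p (fun n => a *: f n + g n).
Proof.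
move=> cf cg e e0.
have a0 : 0 < 4 * (a ^+ 2 + 1) by rewrite mulr_gt0// ltr_wpDl// sqr_ge0.
have [N HN] := cf _ (divr_gt0 e0 a0).
have [M HM] := cg (e / 4) (divr_gt0 e0 (ltr0n _ 4)).
exists (maxn N M) => m n; rewrite !geq_max => /andP[Nm Mm] /andP[Nn Mn].
rewrite (_ : _ - _ = a *: (f m - f n) + (g m - g n)); last first.
  by rewrite scalerBr addrACA opprD.
apply: le_lt_trans (sqnorm_comb_le _ _ _ _) _.
have := HN m n Nm Nn; rewrite ltr_pdivlMr//.
have := HM m n Mm Mn; have := sqnorm_ge0 p (f m - f n).
have := sqnorm_ge0 p (g m - g n); set X := sqnorm _ _; set Y := sqnorm _ _.
have := sqr_ge0 a; nra.
Qed.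

Lemma hermite_coef_derivE f : hermite_coef (schwartz_deriv f) = dstep (hermite_coef f).
Proof. by apply/funext => k; exact: hermite_coef_deriv. Qed.

Lemma hermite_coefZ a f k : hermite_coef (a *: f) k = a * hermite_coef f k.
Proof. exact: (@l2_innerZl R a f (hermite_schwartz k)). Qed.

Lemma hermite_coef_comb3 a b c f g h k :
  hermite_coef (a *: f + (b *: g + c *: h)) k
  = a * hermite_coef f k + (b * hermite_coef g k + c * hermite_coef h k).
Proof. by rewrite 2!hermite_coef_comb hermite_coefZ. Qed.

Lemma sqnorm_deriv_le p : exists C, 0 <= C /\
  forall f, sqnorm p (schwartz_deriv f) <= C * sqnorm (p + 2^-1) f.
Proof.
have [K sw] := hermite_weight_slow p.
have [C [C0 HC]] := dstep_norm_bound sw; exists C; split => // f.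
rewrite !sqnormE hermite_coef_derivE.
apply: le_trans (HC _ (hermite_coef_rapid f)) _.
rewrite le_eqVlt; apply/orP; left; apply/eqP; congr (_ * _).
apply: eq_tsum => k; congr (_ * _); rewrite /hermite_weight.
have x0 : 0 < 2 * k%:R + 1 :> R by rewrite ltr_wpDl// mulr_ge0.
rewrite (_ : 2 * (p + 2^-1) = 2 * p + 1); last by field.
by rewrite powRD ?(lt0r_neq0 x0) ?implybT// powRr1// ltW.
Qed.

Lemma le_sqnorm p q f : p <= q -> sqnorm p f <= sqnorm q f.
Proof.
move=> pq; rewrite /sqnorm !schwartz_innerE.
apply: le_tsum; try exact: inner_summable.
move=> k; rewrite -!mulrA ler_wpM2r -?expr2 ?sqr_ge0//.
by rewrite ler_powR ?lerDr ?mulr_ge0// ler_wpM2l.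
Qed.

Lemma represents_le p q (f : nat -> schwartz R) u :
  p <= q -> represents q f u -> represents p f u.
Proof.
move=> pq [/sobolev_cauchyP cf wf]; split => //.
apply/sobolev_cauchyP => e /cf[N HN]; exists N => m n Nm Nn.
exact: le_lt_trans (le_sqnorm _ pq) (HN m n Nm Nn).
Qed.

Lemma represents_comb p a (f g : nat -> schwartz R) u v :
  represents p f u -> represents p g v ->
  represents p (fun n => a *: f n + g n) (a *: u + v).
Proof.
move=> [/sobolev_cauchyP cf wf] [/sobolev_cauchyP cg wg]; split.
  exact/sobolev_cauchyP/sobolev_cauchy_comb.
move=> phi; rewrite -[(a *: u + v) phi]/(a * u phi + v phi).
under eq_fun do rewrite l2_innerDl l2_innerZl.
by apply: cvgD => //; apply: cvgMl_tmp.
Qed.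

Lemma represents_scale p a (f : nat -> schwartz R) u :
  represents p f u -> represents p (fun n => a *: f n) (a *: u).
Proof.
move=> rf; have := represents_comb (a - 1) rf rf.
rewrite -{2}[u]scale1r -scalerDl subrK.
by under eq_fun do rewrite -{2}[f _]scale1r -scalerDl subrK.
Qed.

Lemma represents_deriv p (f : nat -> schwartz R) u :
  represents (p + 2^-1) f u ->
  represents p (fun n => schwartz_deriv (f n)) (tempered_deriv u).
Proof.
move=> [/sobolev_cauchyP cf wf]; split.
  have [C [C0 HC]] := sqnorm_deriv_le p.
  apply/sobolev_cauchyP => e e0.
  have [|N HN] := cf (e / (C + 1)); first by rewrite divr_gt0// ltr_wpDl.
  exists N => m n Nm Nn; rewrite -schwartz_derivB.
  apply: le_lt_trans (HC _) _; have := HN m n Nm Nn.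
  rewrite ltr_pdivlMr ?ltr_wpDl//; apply: le_lt_trans.
  by rewrite mulrC ler_wpM2l ?sqnorm_ge0// lerDl.
move=> phi; rewrite -[tempered_deriv u phi]/(- u (schwartz_deriv phi)).
by under eq_fun do rewrite l2_inner_deriv; apply: cvgN; exact: wf.
Qed.

(** A finite part of the series for [sqnorm p (f n)] is the limit, as [m] tends to
    infinity, of the same part for [f n - f m], which is at most [e]. *)
Lemma sobolev_cauchy_cvg0 p (f : nat -> schwartz R) : sobolev_cauchy p f ->
  (forall k, hermite_coef (f n) k @[n --> \oo] --> 0) ->
  sqnorm p (f n) @[n --> \oo] --> 0.
Proof.
move=> cf c0; apply/cvgr0Pnorm_le => e e0.
have [N HN] := cf e e0; exists N => // n /= Nn.
rewrite ger0_norm ?sqnorm_ge0//.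
pose s h K := series (fun k => hermite_weight p k * hermite_coef h k
                                * hermite_coef h k) K.
have sle h K : s h K <= sqnorm p h.
  rewrite /sqnorm schwartz_innerE; apply: le_series_tsum; last exact: inner_summable.
  by move=> k; rewrite -mulrA -expr2 mulr_ge0 ?sqr_ge0// ltW// hermite_weight_gt0.
have sc K : s (f n - f m) K @[m --> \oo] --> s (f n) K.
  elim: K => [|K IHK].
    have s0 h : s h 0%N = 0 by rewrite /s seriesEnat/= big_nil.
    by under eq_fun do rewrite s0; rewrite s0; exact: cvg_cst.
  have sS h : s h K.+1 = s h K
      + hermite_weight p K * hermite_coef h K * hermite_coef h K.
    by rewrite /s !seriesEnat/= big_nat_recr.
  under eq_fun do rewrite sS; rewrite sS; apply: cvgD => //.
  have cK : hermite_coef (f n - f m) K @[m --> \oo] --> hermite_coef (f n) K.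
    under eq_fun do rewrite subr_comb hermite_coef_comb.
    exact: cvg_opp_shift.
  by apply: cvgM => //; apply: cvgMl_tmp.
have sle_e K : s (f n) K <= e.
  rewrite -(cvg_lim _ (sc K))//; apply: limr_le.
    by apply/cvg_ex; eexists; exact: sc.
  exists N => // m /= Nm; apply: le_trans (sle _ _) _; exact/ltW/HN.
rewrite /sqnorm schwartz_innerE; apply: limr_le; first exact: inner_summable.
by apply: nearW => K; exact: sle_e.
Qed.

(** Both sequences have the same weak limit, in particular when tested on the
    Hermite functions, so the Hermite coefficients of the difference tend to
    [0]. *)
Lemma represents_unique p (f g : nat -> schwartz R) u :
  represents p f u -> represents p g u ->
  sqnorm p (f n - g n) @[n --> \oo] --> 0.
Proof.
move=> [/sobolev_cauchyP cf wf] [/sobolev_cauchyP cg wg].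
under eq_fun do rewrite subr_comb.
apply: sobolev_cauchy_cvg0; first exact: sobolev_cauchy_comb.
move=> k; under eq_fun do rewrite hermite_coef_comb.
have : -1 * hermite_coef (g n) k + hermite_coef (f n) k @[n --> \oo]
    --> -1 * u (hermite_schwartz k) + u (hermite_schwartz k).
  have Hg : hermite_coef (g n) k @[n --> \oo] --> u (hermite_schwartz k).
    exact: (wg (hermite_schwartz k)).
  have Hf : hermite_coef (f n) k @[n --> \oo] --> u (hermite_schwartz k).
    exact: (wf (hermite_schwartz k)).
  by apply: cvgD => //; apply: cvgMl_tmp.
by rewrite mulN1r addNr.
Qed.

Lemma sobolev_cauchy_bounded p (f : nat -> schwartz R) : sobolev_cauchy p f ->
  exists (B : R) (N : nat), 0 < B /\
    forall n, (N <= n)%N -> sqnorm p (f n) <= B.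
Proof.
move=> /(_ 1 ltr01) [N HN]; exists (2 * sqnorm p (f N) + 2), N; split.
  by rewrite ltr_wpDl// mulr_ge0// sqnorm_ge0.
move=> n Nn; have := sqnorm_comb_le p 1 (f n - f N) (f N).
rewrite scale1r subrK => /le_trans; apply.
by have := HN n N Nn (leqnn N); rewrite expr1n; lra.
Qed.

(** Uniform continuity of the inner product on bounded sets. *)
Lemma inner_close p (e B : R) : 0 < e -> 0 < B -> exists d : R, 0 < d /\
  forall f f' g g', sqnorm p g <= B -> sqnorm p f' <= B ->
    sqnorm p (f - f') < d -> sqnorm p (g - g') < d ->
    `|schwartz_inner p f g - schwartz_inner p f' g'| < e.
Proof.
move=> e0 B0; pose t := e / (4 * B).
have t0 : 0 < t by rewrite divr_gt0// mulr_gt0.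
have d0 : 0 < t * (e / 4) by rewrite mulr_gt0// divr_gt0.
exists (t * (e / 4)); split => // f f' g g' gB fB df dg.
have -> : schwartz_inner p f g - schwartz_inner p f' g'
    = schwartz_inner p (f - f') g + schwartz_inner p (g - g') f'.
  by rewrite !subr_comb !schwartz_inner_comb (schwartz_innerC p g f')
    (schwartz_innerC p g' f'); ring.
have tB : t * B = e / 4 by rewrite /t; field; rewrite lt0r_neq0.
have H1 := inner_le p (f - f') g t0; have H2 := inner_le p (g - g') f' t0.
have P1 := ler_wpM2l (ltW t0) gB; have P2 := ler_wpM2l (ltW t0) fB.
rewrite -ltr_pdivrMl// in df; rewrite -ltr_pdivrMl// in dg.
apply: le_lt_trans (ler_normD _ _) _; apply: le_lt_trans (lerD H1 H2) _.
move: df dg P1 P2; rewrite tB => df dg P1 P2.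
rewrite [e](_ : _ = (e / 4 + e / 4) + (e / 4 + e / 4)); last by field.
exact: (ltrD (ltr_leD df P1) (ltr_leD dg P2)).
Qed.

Lemma represents_inner_cvg p (f g : nat -> schwartz R) u v :
  represents p f u -> represents p g v ->
  cvgn (fun n => schwartz_inner p (f n) (g n)).
Proof.
move=> [/sobolev_cauchyP cf _] [/sobolev_cauchyP cg _].
have [B1 [N1 [B10 H1]]] := sobolev_cauchy_bounded cf.
have [B2 [N2 [B20 H2]]] := sobolev_cauchy_bounded cg.
apply/cauchy_cvgP/cauchy_ballP => e e0; rewrite near_map2.
have [d [d0 Hd]] := inner_close p e0 (addr_gt0 B10 B20).
have [N3 H3] := cf d d0; have [N4 H4] := cg d d0.
pose N := maxn (maxn N1 N2) (maxn N3 N4).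
exists ([set n | N <= n]%N, [set n | N <= n]%N).
  by split; exists N.
move=> [m n] [/=]; rewrite !geq_max.
move=> /andP[/andP[m1 m2] /andP[m3 m4]] /andP[/andP[n1 n2] /andP[n3 n4]].
rewrite /ball/=; apply: Hd; [| |exact: H3|exact: H4].
- by rewrite (le_trans (H2 _ m2))// lerDr ltW.
- by rewrite (le_trans (H1 _ n1))// lerDl ltW.
Qed.

Lemma representativeP p u : hermite_sobolev p u ->
  represents p (representative p u) u.
Proof. by move=> [f rf]; rewrite /representative; case: xgetP => [g -> //|/(_ f)]. Qed.

(** The inner product of the completion is computed by any representatives. *)
Lemma sobolev_inner_cvg p (f g : nat -> schwartz R) u v :
  represents p f u -> represents p g v ->
  schwartz_inner p (f n) (g n) @[n --> \oo] --> sobolev_inner p u v.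
Proof.
move=> rf rg.
have rf' : represents p (representative p u) u by apply: representativeP; exists f.
have rg' : represents p (representative p v) v by apply: representativeP; exists g.
have cl : schwartz_inner p (representative p u n) (representative p v n)
    @[n --> \oo] --> sobolev_inner p u v.
  exact: (represents_inner_cvg rf' rg').
have df := represents_unique rf rf'; have dg := represents_unique rg rg'.
have [B1 [N1 [B10 H1]]] := sobolev_cauchy_bounded ((sobolev_cauchyP _ _).1 rf'.1).
have [B2 [N2 [B20 H2]]] := sobolev_cauchy_bounded ((sobolev_cauchyP _ _).1 rg.1).
have d0 : schwartz_inner p (f n) (g n) - schwartz_inner p
    (representative p u n) (representative p v n) @[n --> \oo] --> 0.
  apply/cvgr0Pnorm_lt => e e0.
  have [d [dd Hd]] := inner_close p e0 (addr_gt0 B10 B20).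
  have /cvgr0Pnorm_lt/(_ d dd) [M1 _ M1d] := df.
  have /cvgr0Pnorm_lt/(_ d dd) [M2 _ M2d] := dg.
  exists (maxn (maxn N1 N2) (maxn M1 M2)) => // n /=.
  rewrite !geq_max => /andP[/andP[n1 n2] /andP[m1 m2]]; apply: Hd.
  - by apply: le_trans (H2 _ n2) _; rewrite lerDr ltW.
  - by apply: le_trans (H1 _ n1) _; rewrite lerDl ltW.
  - exact: le_lt_trans (ler_norm _) (M1d _ m1).
  - exact: le_lt_trans (ler_norm _) (M2d _ m2).
exact: cvg_close d0 cl.
Qed.

Lemma sobolev_inner_ge0 p u : hermite_sobolev p u -> 0 <= sobolev_inner p u u.
Proof.
move=> [f rf]; have c := sobolev_inner_cvg rf rf.
rewrite -(cvg_lim _ c)//; apply: limr_ge; first by apply/cvg_ex; eexists; exact: c.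
by apply: nearW => n; exact: sqnorm_ge0.
Qed.

Lemma sqr_sobolev_norm p u : hermite_sobolev p u ->
  sobolev_norm p u ^+ 2 = sobolev_inner p u u.
Proof. by move=> Su; rewrite sqr_sqrtr// sobolev_inner_ge0. Qed.

Lemma hs_norm_sq_sobolev p u v : hermite_sobolev p u -> hermite_sobolev p v ->
  hs_norm_sq (sobolev_norm p) (u, v) = sobolev_inner p u u + sobolev_inner p v v.
Proof.
by move=> Su Sv; exact: (congr2 +%R (sqr_sobolev_norm Su) (sqr_sobolev_norm Sv)).
Qed.

Lemma hs_norm_sq_schwartz p f g :
  hs_norm_sq (schwartz_norm p) (f, g) = sqnorm p f + sqnorm p g.
Proof. exact: (congr2 +%R (sqr_schwartz_norm p f) (sqr_schwartz_norm p g)). Qed.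

Lemma opLE (V : lmodType R) (d : V -> V) (kappa sigma b : R) x :
  opL d kappa sigma b x = - (kappa ^+ 2 / 2) *: d (d (d (d x)))
    + (sigma ^+ 2 / 2 *: d (d x) + (- b) *: d x).
Proof. by rewrite /opL addrA [(- b) *: _]scaleNr. Qed.

Lemma schwartz_inequality (kappa sigma b p : R) : exists C : R, 0 < C /\
  forall phi : schwartz R,
    2 * schwartz_inner p phi (opL schwartz_deriv kappa sigma b phi)
    + (sqnorm p (opA1 schwartz_deriv sigma phi)
       + sqnorm p (opA2 schwartz_deriv kappa phi)) <= C * sqnorm p phi.
Proof.
have [K sw] := hermite_weight_slow p.
have [C [C0 HC]] := generator_bound sw kappa sigma b.
exists C; split => // phi; rewrite [sqnorm p phi]sqnormE.
apply: le_trans (HC _ (hermite_coef_rapid phi)).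
have D1 := hermite_coef_derivE phi.
have D2 : hermite_coef (schwartz_deriv (schwartz_deriv phi))
    = dstep (dstep (hermite_coef phi)) by rewrite hermite_coef_derivE D1.
have D4 : hermite_coef (schwartz_deriv (schwartz_deriv (schwartz_deriv
    (schwartz_deriv phi)))) = dstep (dstep (dstep (dstep (hermite_coef phi)))).
  by do 2 rewrite hermite_coef_derivE; rewrite D2.
rewrite /sqnorm !schwartz_innerE.
rewrite le_eqVlt; apply/orP; left; apply/eqP; congr (_ * _ + (_ + _)).
- apply: eq_tsum => k; congr (_ * _); rewrite opLE.
  by rewrite hermite_coef_comb3 -D4 -D2 -D1 [- b * _]mulNr addrA.
- by apply: eq_tsum => k; rewrite /opA1 hermite_coefZ D1.
- by apply: eq_tsum => k; rewrite /opA2 hermite_coefZ D2.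
Qed.

Lemma represents_deriv_from p q (f : nat -> schwartz R) u : q = p + 2^-1 ->
  represents q f u -> represents p (fun n => schwartz_deriv (f n)) (tempered_deriv u).
Proof. by move=> ->; exact: represents_deriv. Qed.

Lemma sobolev_inequality (kappa sigma b p C : R) :
  (forall phi : schwartz R,
    2 * schwartz_inner p phi (opL schwartz_deriv kappa sigma b phi)
    + (sqnorm p (opA1 schwartz_deriv sigma phi)
       + sqnorm p (opA2 schwartz_deriv kappa phi)) <= C * sqnorm p phi) ->
  forall u, hermite_sobolev (p + 2) u ->
    2 * sobolev_inner p u (opL tempered_deriv kappa sigma b u)
    + hs_norm_sq (sobolev_norm p) (opA tempered_deriv kappa sigma u)
    <= C * sobolev_norm p u ^+ 2.
Proof.
move=> HC u [f rf].
have r1 : represents (p + 2 - 2^-1) (fun n => schwartz_deriv (f n)) (tempered_deriv u).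
  by apply: represents_deriv_from rf; field.
have r2 := @represents_deriv_from (p + 1) _ _ _ _ r1.
have {}r2 := r2 ltac:(by field).
have r3 := @represents_deriv_from (p + 1 - 2^-1) _ _ _ _ r2.
have {}r3 := r3 ltac:(by field).
have r4 := @represents_deriv_from p _ _ _ _ r3.
have {}r4 := r4 ltac:(by field).
have {}rf : represents p f u by apply: represents_le rf; lra.
have {}r1 := represents_le (_ : p <= p + 2 - 2^-1) r1.
have {}r1 := r1 ltac:(by lra).
have {}r2 := represents_le (_ : p <= p + 1) r2.
have {}r2 := r2 ltac:(by lra).
have rL : represents p (fun n => opL schwartz_deriv kappa sigma b (f n))
    (opL tempered_deriv kappa sigma b u).
  have := represents_comb (- (kappa ^+ 2 / 2)) r4
    (represents_comb (sigma ^+ 2 / 2) r2 (represents_scale (- b) r1)).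
  by rewrite -opLE; under eq_fun do rewrite -opLE.
have rA1 : represents p (fun n => opA1 schwartz_deriv sigma (f n))
    (opA1 tempered_deriv sigma u) by exact: represents_scale.
have rA2 : represents p (fun n => opA2 schwartz_deriv kappa (f n))
    (opA2 tempered_deriv kappa u) by exact: represents_scale.
have HCn n := HC (f n).
have Su : hermite_sobolev p u by eexists; exact: rf.
have S1 : hermite_sobolev p (opA1 tempered_deriv sigma u) by eexists; exact: rA1.
have S2 : hermite_sobolev p (opA2 tempered_deriv kappa u) by eexists; exact: rA2.
rewrite /opA (hs_norm_sq_sobolev S1 S2) (sqr_sobolev_norm Su).
exact: (le_lim_comb HCn (sobolev_inner_cvg rf rL) (sobolev_inner_cvg rA1 rA1)
  (sobolev_inner_cvg rA2 rA2) (sobolev_inner_cvg rf rf)).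
Qed.

End completion.

Theorem corollary2p3 (R : realType) (kappa sigma b p : R) :
  exists C : R, 0 < C /\
    (forall phi : schwartz R,
       2 * schwartz_inner p phi (opL schwartz_deriv kappa sigma b phi)
       + hs_norm_sq (schwartz_norm p) (opA schwartz_deriv kappa sigma phi)
       <= C * schwartz_norm p phi ^+ 2) /\
    (forall phi : tempered R, hermite_sobolev (p + 2) phi ->
       2 * sobolev_inner p phi (opL tempered_deriv kappa sigma b phi)
       + hs_norm_sq (sobolev_norm p) (opA tempered_deriv kappa sigma phi)
       <= C * sobolev_norm p phi ^+ 2).
Proof.
have [C [C0 HC]] := schwartz_inequality kappa sigma b p.
exists C; split => //; split; last exact: sobolev_inequality.
by move=> phi; rewrite /opA hs_norm_sq_schwartz sqr_schwartz_norm; exact: HC.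
Qed.
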